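(* Let $0\le\eta\le2$ be fixed. Suppose $p\to\infty$ and that Assumption 2 (stated in the context) is satisfied. Then $$\frac{\tilde{T}_{m,p}}{\sqrt{[4(m-1)+2\eta]\log p}}\;\to\;1$$ in probability as $n\to\infty$ (so that $p=p_n\to\infty$).
   Context: Let $p=p_n\to\infty$ as $n\to\infty$, and let $m$ be an integer, $2\le m\le p$, possibly depending on $n$ through $p$. Let $\tilde{W}=(\tilde{w}_{ij})_{1\le i,j\le p}$ be a symmetric random matrix whose entries $\tilde w_{ij}$, $i\le j$, are independent with $\tilde{w}_{ii}\sim N(0,\eta)$ and $\tilde{w}_{ij}\sim N(0,1)$ for $i<j$ (here $N(0,\eta)$ is the centered Gaussian with variance $\eta$; $N(0,0)$ is the point mass at $0$). For $S\subset\{1,\dots,p\}$ let $\tilde{W}_S=(\tilde{w}_{ij})_{i,j\in S}$, and let $\lambda_1(A)$ denote the largest eigenvalue of a symmetric matrix $A$. Define $$\tilde{T}_{m,p}=\max_{S\subset\{1,\dots,p\},\,|S|=m}\lambda_1(\tilde{W}_S).$$ Assumption 2: either $m\ge2$ is fixed, or $m\to\infty$ with $m=o\left(\frac{(\log p)^{1/3}}{\log\log p}\right)$. *)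

(* Defs.v *)
From mathcomp Require Import all_boot all_order all_algebra.
From mathcomp Require Import all_classical all_reals all_analysis.

Set Implicit Arguments.
Unset Strict Implicit.
Unset Printing Implicit Defensive.

Import Order.TTheory GRing.Theory Num.Theory.
Import numFieldNormedType.Exports.

Local Open Scope classical_set_scope.
Local Open Scope ring_scope.

(* The library's [normal_prob m s] is parametrised by the standard deviation s,
   and for s = 0 it is the uniform law on [0, 1] rather than a point mass. *)
Definition centered_gaussian (R : realType) (v : R) : set R -> \bar R :=
  if v == 0 then \d_(0 : R) else normal_prob 0 (Num.sqrt v).

Definition mutually_independent d (T : measurableType d) (R : realType)
    (P : probability T R) (I : finType) (D : {set I})
    (X : I -> {RV P >-> R}) : Prop :=
  forall (J : {set I}) (B : I -> set R),
    J \subset D -> (forall i, measurable (B i)) ->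
    P (\bigcap_(i in [set` J]) (X i @^-1` B i))
      = (\prod_(i in J) P (X i @^-1` B i))%E.

Record gaussian_symmetric_matrix d (T : measurableType d) (R : realType)
    (P : probability T R) (eta : R) (p : nat)
    (w : 'I_p -> 'I_p -> {RV P >-> R}) : Prop := GaussianSymmetricMatrix {
  gsm_sym : forall i j omega, w i j omega = w j i omega ;
  gsm_indep : mutually_independent
    [set ij : 'I_p * 'I_p | (ij.1 <= ij.2)%N]%SET
    (fun ij => w ij.1 ij.2) ;
  gsm_diag : forall i (B : set R), measurable B ->
    distribution P (w i i) B = centered_gaussian eta B ;
  gsm_offdiag : forall (i j : 'I_p) (B : set R), (i < j)%N -> measurable B ->
    distribution P (w i j) B = centered_gaussian 1 B }.

(* The set of real eigenvalues of a matrix is finite, and nonempty for a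
   symmetric matrix of positive size; its supremum is then a maximum. *)
Definition lambda1 (R : realType) (n : nat) (A : 'M[R]_n) : R :=
  sup [set a | eigenvalue A a].

Definition principal_submx (R : realType) (p : nat) (A : 'M[R]_p)
    (S : {set 'I_p}) : 'M[R]_#|S| :=
  \matrix_(i, j) A (enum_val i) (enum_val j).

(* For m <= p, a supremum over a finite nonempty set, hence a maximum. *)
Definition max_lambda1 (R : realType) (p m : nat) (A : 'M[R]_p) : R :=
  sup [set lambda1 (principal_submx A S) | S in [set S : {set 'I_p} | #|S| = m]].

Definition Ttilde d (T : measurableType d) (R : realType) (P : probability T R)
    (p m : nat) (w : 'I_p -> 'I_p -> {RV P >-> R}) (omega : T) : R :=
  max_lambda1 m (\matrix_(i, j) w i j omega).

(* The probability space may vary along the sequence. *)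
Definition cvg_in_probability (R : realType) (d : nat -> measure_display)
    (T : forall n, measurableType (d n)) (P : forall n, probability (T n) R)
    (X : forall n, T n -> R) (c : R) : Prop :=
  forall eps : R, 0 < eps ->
    P n [set omega | eps < `|X n omega - c|] @[n --> \oo] --> 0%E.

(* [m] is a function of the dimension, taken along the sequence [p n]. *)
Definition assumption2 (R : realType) (p m : nat -> nat) : Prop :=
  (exists m0, forall n, m (p n) = m0) \/
  ((m (p n) @[n --> \oo] --> \oo) /\
   (fun n => (m (p n))%:R : R^o) =o_\oo
   (fun n => ln (p n)%:R `^ 3^-1 / ln (ln (p n)%:R) : R^o)).

(* Main.v *)
(* Write D = 2(m-1) + eta, so that the normalisation is sqrt (2 D log p).

   Upper bound.  For a unit vector y supported on S, the variance of y W_S y^T is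
   at most D/m, so by Cauchy-Schwarz lambda_1(W_S)^2 is at most D/m times the sum
   of the m(m+1)/2 squared standardised entries of W_S.  Hence lambda_1(W_S) > t
   forces that chi-square-like sum above m t^2 / D.  Rounding each squared entry
   down to an integer turns this into a finite union of boxes, whose
   probabilities factor by independence; no net on the sphere is needed.  With
   t^2 = (1+eps)^2 2 D log p the resulting bound p^-m(1+eps) exp(O(m^2)) beats
   the at most p^m choices of S because m = o(log p).

   Lower bound.  Testing with the flat vector, lambda_1(W_S) >= lam D as soon as
   all off-diagonal entries of W_S are >= 2 lam and all diagonal ones are
   >= eta lam.  Restrict to sets S that pick one index in each of m disjoint
   blocks of length L = floor(p/m).  For two such sets the two box events are
   correlated only through the pairs in S cap S', and the normalised second
   moment of the weighted count is at most (1 + (G-1)/L)^m with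
   G = p^(1-eps+o(1)), so it tends to 1.  This again needs only m = o(log p). *)

Require Import Defs.
From mathcomp Require Import all_boot all_order all_algebra.
From mathcomp Require Import all_classical all_reals all_analysis.
From mathcomp Require Import measurable_realfun ring lra.

Import Order.TTheory GRing.Theory Num.Theory.
Import numFieldNormedType.Exports.

Set Implicit Arguments.
Unset Strict Implicit.
Unset Printing Implicit Defensive.

Local Open Scope classical_set_scope.
Local Open Scope ring_scope.

(** * The largest eigenvalue as a Rayleigh quotient *)

Section rayleigh.
Variable R : realType.

Lemma cvg_sumr (I T : Type) (F : set_system T) (FF : Filter F) (r : seq I)
    (f : I -> T -> R) (a : I -> R) :
  (forall i, f i x @[x --> F] --> a i) ->
  \sum_(i <- r) f i x @[x --> F] --> \sum_(i <- r) a i.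
Proof. by move=> fa; apply: cvg_big => //; exact: add_continuous. Qed.

Definition qform n (A : 'M[R]_n) (x : 'rV[R]_n) : R := (x *m A *m x^T) 0 0.

Lemma qformE n (A : 'M[R]_n) x :
  qform A x = \sum_i \sum_j x 0 i * x 0 j * A i j.
Proof.
rewrite /qform mxE exchange_big; apply: eq_bigr => j _ /=.
rewrite !mxE mulr_suml; apply: eq_bigr => i _.
by rewrite mulrAC.
Qed.

Lemma qform1E n (x : 'rV[R]_n) : qform 1%:M x = \sum_i x 0 i ^+ 2.
Proof. by rewrite /qform mulmx1 mxE; apply: eq_bigr => i _; rewrite mxE expr2. Qed.

Lemma qform1_ge0 n (x : 'rV[R]_n) : 0 <= qform 1%:M x.
Proof. by rewrite qform1E sumr_ge0// => i _; exact: sqr_ge0. Qed.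

Lemma qform1_eq0 n (x : 'rV[R]_n) : qform 1%:M x = 0 -> x = 0.
Proof.
rewrite qform1E => /eqP; rewrite psumr_eq0; last by move=> i _; exact: sqr_ge0.
move=> /allP x0; apply/rowP => i; rewrite mxE.
by apply/eqP; rewrite -sqrf_eq0; apply: (x0 i); rewrite mem_index_enum.
Qed.

Lemma qform1_gt0 n (x : 'rV[R]_n) : x != 0 -> 0 < qform 1%:M x.
Proof.
by move=> x0; rewrite lt_def qform1_ge0 andbT; apply: contra x0 => /eqP/qform1_eq0 ->.
Qed.

Lemma qform_eigen n (A : 'M[R]_n) (a : R) (x : 'rV[R]_n) :
  x *m A = a *: x -> qform A x = a * qform 1%:M x.
Proof. by move=> xA; rewrite /qform xA mulmx1 -scalemxAl mxE. Qed.

Lemma qformZ n (A : 'M[R]_n) (a : R) (x : 'rV[R]_n) :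
  qform A (a *: x) = a ^+ 2 * qform A x.
Proof.
by rewrite /qform -!scalemxAl linearZ/= -scalemxAr scalerA mxE expr2.
Qed.

Lemma continuous_qform n (A : 'M[R]_n) : continuous (qform A).
Proof.
have -> : qform A = fun x => \sum_i \sum_j x 0 i * x 0 j * A i j.
  by apply/funext => x; exact: qformE.
move=> x; apply: (cvg_sumr (nbhs_filter x)) => i.
apply: (cvg_sumr (nbhs_filter x)) => j.
apply: (@cvgM _ _ _ (nbhs_filter x) (fun y => y 0 i * y 0 j)
  (fun=> A i j)); last exact: cvg_cst.
by apply: (@cvgM _ _ _ (nbhs_filter x) (fun y => y 0 i) (fun y => y 0 j));
  exact: coord_continuous.
Qed.

Lemma qform1_eq1_compact n : compact [set x : 'rV[R]_n | qform 1%:M x = 1].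
Proof.
apply: bounded_closed_compact; last first.
  by apply: (@preimage_closed _ _ (qform 1%:M) [set 1]); [move=> x _; exact: continuous_qform|exact: closed_eq].
exists 1; split=> // M M1 x /= x1.
rewrite [`|x|]mx_normrE; apply/bigmax_leP; split=> [|[i j] _ /=].
  by rewrite ltW// (lt_trans ltr01).
rewrite (le_trans _ (ltW M1))// -(@ler_pXn2r _ 2)// ?nnegrE//.
rewrite expr1n -x1 qform1E real_normK ?num_real// (ord1 i).
by rewrite (bigD1 j)//= lerDl sumr_ge0// => k _; exact: sqr_ge0.
Qed.

(** First-variation argument: at [t = - b / (|c| + 1)] the linear term dominates and the value is
    negative unless [b = 0]. The [+ 1] keeps the denominator positive when [c = 0]. *)
Lemma quadratic_ge0_lin_eq0 (b c : R) :
  (forall t, 0 <= 2 * t * b + t ^+ 2 * c) -> b = 0.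
Proof.
move=> h; apply/eqP/negPn/negP => b0.
have k0 : 0 < `|c| + 1 by rewrite ltr_wpDl.
have := h (- b / (`|c| + 1)).
have -> : 2 * (- b / (`|c| + 1)) * b + (- b / (`|c| + 1)) ^+ 2 * c =
  (b / (`|c| + 1)) ^+ 2 * (c - 2 * (`|c| + 1)).
  by field; rewrite gt_eqF.
have bk : 0 < (b / (`|c| + 1)) ^+ 2.
  by rewrite exprn_even_gt0//= mulf_neq0// invr_neq0// gt_eqF.
rewrite pmulr_rge0// => H; have := ler_norm c; lra.
Qed.

(** The form attains its maximum [mu] over the compact unit sphere at some [v]. Then [M = mu I - A]
    is positive semidefinite with [v M v^T = 0], and the vanishing first variation at [v] makes [v]
    an eigenvector. *)
Lemma qform_max_eigenvalue n (A : 'M[R]_n) : (0 < n)%N -> A^T = A ->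
  exists2 mu, eigenvalue A mu & forall x, qform A x <= mu * qform 1%:M x.
Proof.
move=> n0 As.
have [||v v1 vmax] := @compact_EVT_max _ R (qform A) _ _ (@qform1_eq1_compact n).
- exists (delta_mx 0 (Ordinal n0)) => /=.
  rewrite qform1E (bigD1 (Ordinal n0))//= mxE !eqxx expr1n big1 ?addr0// => i i0.
  by rewrite mxE (negbTE i0) andbF expr0n.
- by apply: continuous_subspaceT => x; exact: continuous_qform.
set mu := qform A v; move: v1; rewrite inE /= => v1.
have le_mu x : qform A x <= mu * qform 1%:M x.
  have [x0|x0] := eqVneq (qform 1%:M x) 0.
    by rewrite x0 (qform1_eq0 x0) mulr0 /qform !mul0mx mxE.
  have gx : 0 < qform 1%:M x by rewrite lt_def x0 qform1_ge0.
  have := vmax ((Num.sqrt (qform 1%:M x))^-1 *: x).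
  rewrite inE/= !qformZ exprVn (sqr_sqrtr (qform1_ge0 x)) mulVf// => /(_ erefl).
  by rewrite -/mu ler_pdivrMl// mulrC.
exists mu => //; apply/eigenvalueP; exists v; last first.
  by apply/eqP => v0; move: v1; rewrite v0 /qform !mul0mx mxE => /esym/eqP; rewrite oner_eq0.
pose M := mu%:M - A; have Ms : M^T = M by rewrite /M linearB/= tr_scalar_mx As.
have qM x : qform M x = mu * qform 1%:M x - qform A x.
  by rewrite /qform /M mulmxBr mulmxBl mul_mx_scalar mulmx1 -scalemxAl !mxE.
pose u := v *m M; have uE : u = v *m M by [].
suff : u = 0.
  by rewrite uE /M mulmxBr mul_mx_scalar => /eqP; rewrite subr_eq0 => /eqP.
clearbody M u.
(* Moving [v] in the direction [u = v M] gives the form of [M] the value [2 t |u|^2 + t^2 u M u^T],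
   nonnegative for every [t]; hence [|u|^2 = 0]. *)
apply: qform1_eq0; apply: (@quadratic_ge0_lin_eq0 _ (qform M u)) => t.
have <- : qform M (v + t *: u) = 2 * t * qform 1%:M u + t ^+ 2 * qform M u.
  have vM0 : qform M v = 0 by rewrite qM v1 mulr1 subrr.
  have uv : u *m M *m v^T = u *m u^T.
    by rewrite -mulmxA uE trmx_mul Ms.
  have tr : (v + t *: u)^T = v^T + t *: u^T by apply/matrixP => i j; rewrite !mxE.
  move: vM0; rewrite /qform tr !mulmxDl !mulmxDr.
  rewrite -!scalemxAl -!scalemxAr uv mulmx1 -uE.
  by rewrite !mxE => ->; ring.
by rewrite qM subr_ge0 le_mu.
Qed.

(** The [mu] of the preceding lemma is an eigenvalue and bounds all the others, so it is the
    supremum that defines [lambda1]. *)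
Lemma lambda1_leP n (A : 'M[R]_n) t : (0 < n)%N -> A^T = A ->
  lambda1 A <= t <-> forall x, qform A x <= t * qform 1%:M x.
Proof.
move=> n0 As; have [mu emu mux] := qform_max_eigenvalue n0 As.
have ubmu : ubound [set a | eigenvalue A a] mu.
  move=> a /= /eigenvalueP[v va v0].
  by have := mux v; rewrite (qform_eigen va) ler_pM2r// qform1_gt0.
have -> : lambda1 A = mu.
  apply/eqP; rewrite eq_le; apply/andP; split.
    by apply: ge_sup => //; exists mu.
  by apply: ub_le_sup => //; exists mu.
split=> [mut x|h].
  by rewrite (le_trans (mux x))// ler_wpM2r// qform1_ge0.
move/eigenvalueP: emu => [v va v0].
by have := h v; rewrite (qform_eigen va) ler_pM2r// qform1_gt0.
Qed.

End rayleigh.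

(** * Largest eigenvalues of principal submatrices *)

Section submatrix_form.
Variables (R : realType) (p : nat).
Implicit Types (A : 'M[R]_p) (S : {set 'I_p}) (y : 'I_p -> R).

(** Vectors are indexed by all of ['I_p], with only the coordinates in [S] read, so that all sets
    share one type of test vectors. *)
Definition subform A S y := \sum_(i in S) \sum_(j in S) y i * y j * A i j.

Lemma lambda1_principal_leP A S t : A^T = A -> (0 < #|S|)%N ->
  lambda1 (principal_submx A S) <= t <->
  forall y, subform A S y <= t * \sum_(i in S) y i ^+ 2.
Proof.
move=> As S0; have As' : (principal_submx A S)^T = principal_submx A S.
  by apply/matrixP => i j; rewrite !mxE -[in LHS]As mxE.
have eqf (y : 'I_p -> R) : subform A S y =
    qform (principal_submx A S) (\row_i y (enum_val i)).
  rewrite qformE /subform big_enum_val; apply: eq_bigr => i _.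
  rewrite big_enum_val; apply: eq_bigr => j _.
  by rewrite !mxE.
have eq1 (y : 'I_p -> R) : \sum_(i in S) y i ^+ 2 =
    qform 1%:M (\row_(i < #|S|) y (enum_val i)).
  by rewrite qform1E big_enum_val; apply: eq_bigr => i _; rewrite !mxE.
rewrite (lambda1_leP _ S0 As'); split=> [h y|h x]; first by rewrite eqf eq1.
have [x0 x0S] : exists x0, x0 \in S by apply/set0Pn; rewrite -card_gt0.
(* [enum_rank_in] sends indices outside [S] to a default position; the form on [S] never reads those
   values. *)
pose y i := x 0 (enum_rank_in x0S i).
have -> : x = \row_i y (enum_val i).
  by apply/rowP => i; rewrite mxE /y enum_valK_in.
by rewrite -eqf -eq1.
Qed.

Lemma max_lambda1_leP A m t : A^T = A -> (0 < m <= p)%N ->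
  max_lambda1 m A <= t <->
  forall S, #|S| = m -> forall y, subform A S y <= t * \sum_(i in S) y i ^+ 2.
Proof.
move=> As /andP[m0 mp]; pose F := [set lambda1 (principal_submx A S) |
  S in [set S : {set 'I_p} | #|S| = m]].
(* [sup] is meaningful only for a bounded nonempty set: the sum of all absolute values is a crude
   bound, and [m <= p] provides a set of size [m]. *)
have Fub : has_ubound F.
  exists (\sum_(S : {set 'I_p}) `|lambda1 (principal_submx A S)|) => _ /= [S _ <-].
  rewrite (bigD1 S)//= (le_trans (ler_norm _))// lerDl sumr_ge0//.
have F0 : F !=set0.
  have [S Sm] : exists S : {set 'I_p}, #|S| == m.
    have : (0 < #|[set S : {set 'I_p} | #|S| == m]%SET|)%N.
      by rewrite card_draws card_ord bin_gt0.
    by rewrite card_gt0 => /set0Pn[S]; rewrite inE => Sm; exists S.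
  by exists (lambda1 (principal_submx A S)); exists S => //=; exact/eqP.
have -> : max_lambda1 m A <= t <->
    forall S, #|S| = m -> lambda1 (principal_submx A S) <= t.
  split=> [Ft S Sm|h]; last by apply: ge_sup => // _ [S /= Sm <-]; exact: h.
  by apply: le_trans Ft; apply: ub_le_sup => //; exists S.
by split=> h S Sm; apply/lambda1_principal_leP => //; rewrite ?Sm//; exact: h.
Qed.

Lemma rat_approx (x : R) : exists r : nat -> rat,
  ratr (r n) @[n --> \oo] --> x.
Proof.
have h n : exists q : rat, `|ratr q - x| <= (n.+1%:R)^-1.
  have [|q] := @rat_in_itvoo R x (x + n.+1%:R^-1).
    by rewrite ltrDl invr_gt0.
  rewrite in_itv/= => /andP[xq qx]; exists q.
  by rewrite ger0_norm ?lerBlDl; [exact: ltW|rewrite subr_ge0 ltW].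
have [r rP] := choice h; exists r.
apply/cvgrPdist_le => e e0; near=> n.
rewrite distrC (le_trans (rP n))//.
near: n; have /cvgrPdist_le /(_ e e0) := @cvg_harmonic R.
by apply: filterS => n; rewrite sub0r normrN ger0_norm ?harmonic_ge0.
Unshelve. all: by end_near. Qed.

(* Rational test vectors suffice, so that {Ttilde <= t} is a countable
   intersection of measurable events. *)
Lemma subform_le_rat A S t :
  (forall r : {ffun 'I_p -> rat},
    subform A S (ratr \o r) <= t * \sum_(i in S) ratr (r i) ^+ 2) ->
  forall y, subform A S y <= t * \sum_(i in S) y i ^+ 2.
Proof.
move=> h y; have [r rP] := choice (fun i => rat_approx (y i)).
apply: (@ler_cvg_to _ \oo _ _
  (fun n => subform A S (fun i => ratr (r i n)))
  (fun n => t * \sum_(i in S) ratr (r i n) ^+ 2)).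
- rewrite /subform; under eq_fun do rewrite big_mkcond/=.
  rewrite big_mkcond/=; apply: cvg_sumr => i; case: ifP => _; last exact: cvg_cst.
  under eq_fun do rewrite big_mkcond/=.
  rewrite big_mkcond/=; apply: cvg_sumr => j; case: ifP => _; last exact: cvg_cst.
  by apply: cvgM; [apply: cvgM; exact: rP|exact: cvg_cst].
- apply: cvgM; first exact: cvg_cst.
  under eq_fun do rewrite big_mkcond/=.
  rewrite big_mkcond/=; apply: cvg_sumr => i; case: ifP => _; last exact: cvg_cst.
  under eq_fun do rewrite expr2.
  by rewrite expr2; apply: cvgM; exact: rP.
- apply: nearW => n; have := h [ffun i => r i n].
  have -> : ratr \o [ffun i => r i n] = (fun i => ratr (r i n)) :> ('I_p -> R).
    by apply/funext => i; rewrite /= ffunE.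
  by under eq_bigr do rewrite ffunE.
Qed.

End submatrix_form.

(** * Measurability of the maximal eigenvalue *)

Section Ttilde_measurable.
Context d (T : measurableType d) (R : realType) (P : probability T R).
Variables (p m : nat) (w : 'I_p -> 'I_p -> {RV P >-> R}).
Hypotheses (w_sym : forall i j omega, w i j omega = w j i omega)
  (mp : (0 < m <= p)%N).

Let W omega := \matrix_(i, j) w i j omega.

Let W_sym omega : (W omega)^T = W omega.
Proof. by apply/matrixP => i j; rewrite !mxE w_sym. Qed.

Lemma Ttilde_leP t omega : Ttilde m w omega <= t <->
  forall S : {set 'I_p}, #|S| = m -> forall y : 'I_p -> R,
  \sum_(i in S) \sum_(j in S) y i * y j * w i j omega <=
    t * \sum_(i in S) y i ^+ 2.
Proof.
rewrite /Ttilde (max_lambda1_leP _ (W_sym omega) mp).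
have e S y : subform (W omega) S y =
    \sum_(i in S) \sum_(j in S) y i * y j * w i j omega.
  by apply: eq_bigr => i _; apply: eq_bigr => j _; rewrite mxE.
by split=> h S Sm y; have := h S Sm y; rewrite e.
Qed.

Lemma measurable_Ttilde : measurable_fun setT (Ttilde m w).
Proof.
apply: (measurability _ (RGenOInfty.measurableE R)) => //.
move=> _ [_ [t ->]] <-; rewrite setTI.
have -> : Ttilde m w @^-1` `]t, +oo[ = ~` [set omega | Ttilde m w omega <= t].
  by apply/seteqP; split=> omega /=; rewrite in_itv/= andbT ltNge => /negP.
apply: measurableC.
(* Sets of the wrong size contribute the whole space, so that the intersection runs over a full
   countable type. *)
pose G (Sr : {set 'I_p} * {ffun 'I_p -> rat}) : set T :=
  if #|Sr.1| == m then
    [set omega | \sum_(i in Sr.1) \sum_(j in Sr.1)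
       ratr (Sr.2 i) * ratr (Sr.2 j) * w i j omega <=
       t * \sum_(i in Sr.1) ratr (Sr.2 i) ^+ 2] else setT.
have -> : [set omega | Ttilde m w omega <= t] = ~` (\bigcup_Sr ~` G Sr).
  rewrite setC_bigcup; under eq_bigcapr do rewrite setCK.
  apply/seteqP; split=> omega /=.
    move=> /Ttilde_leP h [S r] _; rewrite /G/=; case: eqP => //= Sm.
    exact: (h S Sm (ratr \o r)).
  move=> h; apply/Ttilde_leP => S Sm y.
  have := @subform_le_rat R p (W omega) S t _ y; rewrite /subform.
  have e y' : \sum_(i in S) \sum_(j in S) y' i * y' j * W omega i j =
      \sum_(i in S) \sum_(j in S) y' i * y' j * w i j omega.
    by apply: eq_bigr => i _; apply: eq_bigr => j _; rewrite mxE.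
  rewrite e; apply => r; rewrite e.
  by have := h (S, r) I; rewrite /G /= Sm eqxx.
apply: measurableC; apply: countable_bigcupT_measurable => [|[S r]].
  exact: countableP.
apply: measurableC; rewrite /G/=; case: ifP => // _.
set c := t * _; rewrite (_ : mkset _ = setT `&` (fun omega =>
    \sum_(i in S) \sum_(j in S) ratr (r i) * ratr (r j) * w i j omega)
    @^-1` `]-oo, c]); last first.
  by rewrite setTI; apply/seteqP; split=> omega /=; rewrite in_itv.
suff h : measurable_fun setT (fun omega =>
    \sum_(i in S) \sum_(j in S) ratr (r i) * ratr (r j) * w i j omega).
  by apply: h => //; exact: measurable_itv.
apply: (eq_measurable_fun (fun omega => \sum_i if i \in S then
    \sum_j if j \in S then ratr (r i) * ratr (r j) * w i j omega else 0
  else 0)).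
  move=> omega _; rewrite [RHS]big_mkcond; apply: eq_bigr => i _.
  by case: ifP => // _; rewrite [RHS]big_mkcond.
apply: measurable_sum => i; case: (i \in S) => //.
apply: measurable_sum => j; case: (j \in S) => //.
exact: measurable_funM.
Qed.

End Ttilde_measurable.

(** * Gaussian tails *)

Section gaussian_tails.
Variable R : realType.

(* The clause [x != 0] matters only for the point mass v = 0: it makes the event
   null when k > 0, as it should be. *)
Definition tail_set (v : R) (k : nat) : set R :=
  [set x | (k == 0%N) || (x != 0) && (k%:R * v <= x ^+ 2)].

Lemma measurable_tail_set v k : measurable (tail_set v k).
Proof.
rewrite /tail_set; case: k => [|k].
  by rewrite (_ : mkset _ = setT)//; apply/seteqP; split.
have -> : [set x : R | (k.+1 == 0%N) || (x != 0) && (k.+1%:R * v <= x ^+ 2)] =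
    ~` [set 0] `&` (setT `&` (fun x => x ^+ 2) @^-1` `[k.+1%:R * v, +oo[).
  apply/seteqP; split=> x /=; rewrite in_itv/= andbT.
    by move=> /andP[/eqP].
  by move=> [/eqP -> [_ ->]].
apply: measurableI; first exact: measurableC.
suff h : measurable_fun setT (fun x : R => x ^+ 2) by apply: h => //; exact: measurable_itv.
exact: measurable_funX.
Qed.

Lemma centered_gaussian_le1 (v : R) A : measurable A ->
  (centered_gaussian v A <= 1)%E.
Proof.
by rewrite /centered_gaussian; case: ifP => _ mA; exact: probability_le1.
Qed.

(** A Chernoff bound by change of variance: the density of N(0, v) is (1 - 2 th)^(-1/2) exp(- th x^2
    / v) times that of N(0, v / (1 - 2 th)), and x^2 >= k v on the tail. The second density has
    total mass 1. *)
Lemma gaussian_tail (th v : R) k : 0 <= th < 2^-1 -> 0 <= v ->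
  (centered_gaussian v (tail_set v k) <=
    ((Num.sqrt (1 - 2 * th))^-1 * expR (- (th * k%:R)))%:E)%E.
Proof.
move=> /andP[th0 th1] v0.
have t0 : 0 < 1 - 2 * th by lra.
set c := Num.sqrt (1 - 2 * th).
have c0 : 0 < c by rewrite sqrtr_gt0.
have c1 : 1 <= c^-1.
  rewrite invf_ge1// -[leRHS]sqrtr1 ler_sqrt//; lra.
(* For [k = 0] the tail is the whole line, and the bound is at least 1 because [c^-1 >= 1]. *)
case: k => [|k].
  rewrite mulr0 oppr0 expR0 mulr1; apply: le_trans (_ : (1 <= _)%E); last by rewrite lee_fin.
  by apply: centered_gaussian_le1; exact: measurable_tail_set.
rewrite /centered_gaussian; case: eqVneq => [->|vn0].
  rewrite diracE memNset; last by rewrite /tail_set/= eqxx.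
  by rewrite lee_fin mulr_ge0 ?expR_ge0// invr_ge0 ltW.
have {vn0}v0 : 0 < v by rewrite lt_def vn0.
have sv : Num.sqrt v != 0 by rewrite gt_eqF// sqrtr_gt0.
have svc : Num.sqrt v / c != 0 by rewrite mulf_neq0// invr_neq0// gt_eqF.
have pdf_le x : tail_set v k.+1 x -> normal_pdf 0 (Num.sqrt v) x <=
    c^-1 * expR (- (th * k.+1%:R)) * normal_pdf 0 (Num.sqrt v / c) x.
  move=> /andP[_ kx]; rewrite !normal_pdfE// /normal_peak /normal_fun !subr0.
  rewrite !expr_div_n /c sqr_sqrtr ?(ltW v0)// sqr_sqrtr ?(ltW t0)//.
  have -> : (Num.sqrt (v / (1 - 2 * th) * pi *+ 2))^-1 =
      Num.sqrt (1 - 2 * th) * (Num.sqrt (v * pi *+ 2))^-1.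
    have -> : v / (1 - 2 * th) * pi *+ 2 = (1 - 2 * th)^-1 * (v * pi *+ 2).
      by move: (1 - 2 * th)^-1 (@pi R) => a b; ring.
    by rewrite sqrtrM ?invr_ge0 ?(ltW t0)// sqrtrV ?(ltW t0)// invfM invrK.
  rewrite -/c -[leRHS]mulrA [leRHS](_ : _ =
    (Num.sqrt (v * pi *+ 2))^-1 * (expR (- (th * k.+1%:R)) *
      expR (- x ^+ 2 / (v / (1 - 2 * th) *+ 2)))); last first.
    by field; rewrite !gt_eqF// sqrtr_gt0 pmulrn_lgt0// mulr_gt0// pi_gt0.
  rewrite ler_wpM2l ?invr_ge0 ?sqrtr_ge0// -expRD ler_expR.
  have -> : - x ^+ 2 / (v *+ 2) = - (x ^+ 2 / v) / 2.
    by rewrite -mulr_natr; field; rewrite gt_eqF.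
  have -> : - x ^+ 2 / (v / (1 - 2 * th) *+ 2) = - (x ^+ 2 / v) * (1 - 2 * th) / 2.
    by rewrite -mulr_natr; field; rewrite !gt_eqF.
  have : k.+1%:R <= x ^+ 2 / v by rewrite ler_pdivlMr.
  by move=> h; have := ler_wpM2l th0 h; lra.
have mB := measurable_tail_set v k.+1.
rewrite /normal_prob; apply: (@le_trans _ _
  (\int[lebesgue_measure]_(x in tail_set v k.+1)
    ((c^-1 * expR (- (th * k.+1%:R)))%:E * (normal_pdf 0 (Num.sqrt v / c) x)%:E))%E).
  apply: ge0_le_integral => //.
  - by move=> x _; rewrite lee_fin normal_pdf_ge0.
  - by apply: measurable_funTS; apply/measurable_EFinP; exact: measurable_normal_pdf.
  - apply: measurable_funTS; under eq_fun do rewrite -EFinM; apply/measurable_EFinP.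
    by apply: measurable_funM => //; exact: measurable_normal_pdf.
rewrite ge0_integralZl//; last 3 first.
- by apply: measurable_funTS; apply/measurable_EFinP; exact: measurable_normal_pdf.
- by move=> x _; rewrite lee_fin normal_pdf_ge0.
- by rewrite lee_fin mulr_ge0 ?expR_ge0// ?invr_ge0 ltW.
rewrite -[leRHS]mule1 lee_wpmul2l//; first by rewrite lee_fin mulr_ge0 ?expR_ge0// ?invr_ge0 ltW.
exact: (@probability_le1 _ _ _ (normal_prob 0 (Num.sqrt v / c))).
Qed.

(** The first stretch of one standard deviation in the half-line suffices: the density there is at
    least its value at the right end. For [v = 0] the half-line contains the atom 0 and has mass
    1. *)
Lemma gaussian_lower_tail (v x : R) : 0 <= v -> 0 <= x ->
  (((Num.sqrt (2 * pi))^-1 * expR (- (x + 1) ^+ 2 / 2))%:E <=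
    centered_gaussian v `[(x * Num.sqrt v)%R, +oo[)%E.
Proof.
move=> v0 x0; have pi0 := pi_gt0 R.
rewrite /centered_gaussian; case: eqVneq => [->|vn0].
  rewrite sqrtr0 mulr0 diracE mem_set/= ?in_itv/= ?lexx// lee_fin -[leRHS]mulr1.
  apply: ler_pM; rewrite ?expR_ge0 ?invr_ge0 ?sqrtr_ge0//.
    rewrite invf_le1 ?sqrtr_gt0 ?mulr_gt0// -[leLHS]sqrtr1 ler_sqrt ?mulr_ge0 ?ltW//.
    have := pi_ge2 R; lra.
  by rewrite -expR0 ler_expR mulNr oppr_le0 mulr_ge0// sqr_ge0.
have {vn0}v0 : 0 < v by rewrite lt_def vn0.
set s := Num.sqrt v; have s0 : 0 < s by rewrite sqrtr_gt0.
have ss : s ^+ 2 = v by rewrite sqr_sqrtr// ltW.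
have mu1 : (lebesgue_measure (`[(x * s)%R, ((x + 1) * s)%R] : set R) = s%:E)%E.
  rewrite lebesgue_measure_itv/= lte_fin ltr_pM2r// ltrDl ltr01 -EFinB.
  by congr EFin; ring.
rewrite /normal_prob; apply: (@le_trans _ _ (\int[lebesgue_measure]_(y in
    `[(x * s)%R, ((x + 1) * s)%R]) (normal_pdf 0 s y)%:E)%E); last first.
  apply: ge0_subset_integral => //.
  - by apply: measurable_funTS; apply/measurable_EFinP; exact: measurable_normal_pdf.
  - by move=> y _; rewrite lee_fin normal_pdf_ge0.
  - by move=> y /=; rewrite !in_itv/= => /andP[-> _].
apply: (@le_trans _ _ (\int[lebesgue_measure]_(y in
    `[(x * s)%R, ((x + 1) * s)%R]) (normal_peak s * expR (- (x + 1) ^+ 2 / 2))%:E)%E).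
  rewrite integral_cst// [X in (_ <= _ * X)%E]mu1 -EFinM lee_fin /normal_peak ss.
  have -> : Num.sqrt (v * pi *+ 2) = s * Num.sqrt (2 * pi).
    by rewrite -sqrtrM ?ltW//; congr Num.sqrt; move: (@pi R) => a; ring.
  rewrite le_eqVlt; apply/orP; left; apply/eqP; field.
  by rewrite !gt_eqF// sqrtr_gt0 mulr_gt0.
apply: ge0_le_integral => //.
- by move=> y _; rewrite lee_fin mulr_ge0 ?expR_ge0// normal_peak_ge0.
- by apply: measurable_funTS; apply/measurable_EFinP; exact: measurable_normal_pdf.
- move=> y /=; rewrite in_itv/= => /andP[xy yx].
  rewrite lee_fin normal_pdfE ?gt_eqF// ler_wpM2l ?normal_peak_ge0// /normal_fun ler_expR subr0 ss.
  have -> : - y ^+ 2 / (v *+ 2) = - (y / s) ^+ 2 / 2.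
    by rewrite -ss -mulr_natr; field; rewrite gt_eqF.
  have y0 : 0 <= y / s by rewrite divr_ge0 ?(ltW s0)// (le_trans _ xy)// mulr_ge0// ltW.
  have yx' : y / s <= x + 1 by rewrite ler_pdivrMr.
  rewrite ler_wpM2r// lerN2 lerXn2r// nnegrE; lra.
Qed.

End gaussian_tails.

(** * Upper bound *)

Section index_pairs.
Variables (p : nat).
Implicit Types S : {set 'I_p}.

(** Indexes the independent entries of W_S: each off-diagonal entry once, together with the
    diagonal. *)
Definition pairs S : {set 'I_p * 'I_p} :=
  [set e | [&& e.1 \in S, e.2 \in S & (e.1 <= e.2)%N]]%SET.

Lemma pairsP S e : reflect [/\ e.1 \in S, e.2 \in S & (e.1 <= e.2)%N] (e \in pairs S).
Proof. by rewrite inE; exact: and3P. Qed.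

Lemma card_pairs_le S : (#|pairs S| <= #|S| ^ 2)%N.
Proof.
rewrite -mulnn -cardsX subset_leq_card//; apply/fintype.subsetP => e /pairsP[e1 e2 _].
by rewrite inE e1.
Qed.

(** Swapping coordinates maps the strict lower triangle onto the strict upper one; this accounts for
    the weight 2. *)
Lemma big_sym_pairs (R : realType) S (F : 'I_p -> 'I_p -> R) :
  (forall i j, F i j = F j i) ->
  \sum_(i in S) \sum_(j in S) F i j =
  \sum_(e in pairs S) (if e.1 == e.2 then 1 else 2) * F e.1 e.2.
Proof.
move=> Fs; rewrite pair_big/=.
rewrite (bigID (fun e : 'I_p * 'I_p => (e.1 <= e.2)%N))/=.
have -> : \sum_(i | (i.1 \in S) && (i.2 \in S) && ~~ (i.1 <= i.2)%N) F i.1 i.2 =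
    \sum_(e in pairs S | e.1 != e.2) F e.1 e.2.
  rewrite (reindex_inj (h := fun e : 'I_p * 'I_p => (e.2, e.1)))/=; last first.
    by move=> [a b] [c e] /= [-> ->].
  apply: eq_big => [e|e _]; last exact: Fs.
  rewrite inE -ltnNge ltn_neqAle andbA andbC -val_eqE/=.
  by case: (e.1 \in S); case: (e.2 \in S); case: (_ <= _)%N; case: (_ == _).
rewrite [X in _ + X]big_mkcondr/= [X in X + _](_ : _ = \sum_(e in pairs S) F e.1 e.2); last first.
  by apply: eq_bigl => e; rewrite inE andbA.
rewrite -big_split/=; apply: eq_bigr => e _.
by case: eqP => _ /=; rewrite ?mul1r ?addr0// mulrDl mul1r.
Qed.

End index_pairs.

(** * Quadratic forms controlled by the energy of the entries *)

Section energy_bound.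
Variables (R : realType) (p : nat) (eta : R).
Hypothesis heta : 0 <= eta <= 2.

Definition entry_var (e : 'I_p * 'I_p) : R := if e.1 == e.2 then eta else 1.

Lemma entry_var_ge0 e : 0 <= entry_var e.
Proof. by rewrite /entry_var; case: ifP => // _; case/andP: heta. Qed.

(** Expand [(s c x v - w)^2 >= 0] and divide by [s v]; when [v = 0], [w] vanishes. The free [s] is
    optimised after summation, which yields Cauchy-Schwarz. *)
Lemma weighted_amgm (c x w v k s : R) : 0 <= v -> 0 <= k -> 0 < s ->
  w ^+ 2 <= v * k -> 2 * (c * (x * w)) <= s * (c ^+ 2 * v * x ^+ 2) + k / s.
Proof.
move=> v0 k0 s0 wvk.
have [vE|vn0] := eqVneq v 0.
  have -> : w = 0.
    apply/eqP; rewrite -sqrf_eq0 eq_le sqr_ge0 andbT.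
    by move: wvk; rewrite vE mul0r.
  by rewrite vE !(mulr0, mul0r) add0r divr_ge0// ltW.
have {vn0}v0 : 0 < v by rewrite lt_def vn0.
have : 0 <= (s * c * x * v - w) ^+ 2 by exact: sqr_ge0.
move=> h; rewrite -(ler_pM2l (mulr_gt0 s0 v0)).
have -> : s * v * (s * (c ^+ 2 * v * x ^+ 2) + k / s) =
  s ^+ 2 * c ^+ 2 * x ^+ 2 * v ^+ 2 + v * k by field; rewrite gt_eqF.
nra.
Qed.

(** The squared deviations of the [y i ^+ 2] from their mean have a nonnegative sum. *)
Lemma sum_quartic_ge (I : finType) (S : {set I}) (y : I -> R) : (0 < #|S|)%N ->
  (\sum_(i in S) y i ^+ 2) ^+ 2 / #|S|%:R <= \sum_(i in S) y i ^+ 4.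
Proof.
move=> S0; set n2 := \sum_(i in S) y i ^+ 2.
have m0 : 0 < #|S|%:R :> R by rewrite ltr0n.
have : 0 <= \sum_(i in S) (y i ^+ 2 - n2 / #|S|%:R) ^+ 2.
  by apply: sumr_ge0 => i _; exact: sqr_ge0.
have -> : \sum_(i in S) (y i ^+ 2 - n2 / #|S|%:R) ^+ 2 =
    \sum_(i in S) y i ^+ 4 - 2 * (n2 / #|S|%:R) * n2 + (n2 / #|S|%:R) ^+ 2 * #|S|%:R.
  set a := n2 / _; rewrite (eq_bigr (fun i => y i ^+ 4 - 2 * a * y i ^+ 2 + a ^+ 2)).
    by rewrite big_split/= sumrB -mulr_sumr sumr_const mulr_natr.
  by move=> i _; ring.
have -> : (n2 / #|S|%:R) ^+ 2 * #|S|%:R = n2 ^+ 2 / #|S|%:R.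
  by field; rewrite gt_eqF.
have -> : 2 * (n2 / #|S|%:R) * n2 = 2 * (n2 ^+ 2 / #|S|%:R).
  by field; rewrite gt_eqF.
lra.
Qed.

(* The variance of the quadratic form at a unit vector y is
   2 - (2 - eta) sum y_i^4, which is at most its value at the flat vector. *)
Lemma form_le_of_energy (S : {set 'I_p}) (W : 'I_p -> 'I_p -> R)
    (k : 'I_p * 'I_p -> R) (t : R) (y : 'I_p -> R) :
  (1 < #|S|)%N -> 0 < t ->
  (forall i j, W i j = W j i) ->
  (forall e, e \in pairs S -> 0 <= k e) ->
  (forall e, e \in pairs S -> W e.1 e.2 ^+ 2 <= entry_var e * k e) ->
  (2 * (#|S|%:R - 1) + eta) * \sum_(e in pairs S) k e <= #|S|%:R * t ^+ 2 ->
  \sum_(i in S) \sum_(j in S) y i * y j * W i j <= t * \sum_(i in S) y i ^+ 2.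
Proof.
move=> S1 t0 Ws k0 Wk; set D := 2 * (#|S|%:R - 1) + eta; set K := \sum_(e in pairs S) k e.
set n2 := \sum_(i in S) y i ^+ 2 => DK.
have /andP[eta0 eta2] := heta.
have mgt1 : 1 < #|S|%:R :> R by rewrite ltr1n.
have m0 : 0 < #|S|%:R :> R by lra.
have D0 : 0 < D by rewrite /D; lra.
have n20 : 0 <= n2 by apply: sumr_ge0 => i _; exact: sqr_ge0.
have [n2E|n2n0] := eqVneq n2 0.
  rewrite n2E mulr0 big1// => i iS; rewrite big1// => j jS.
  have /psumr_eq0P : \sum_(i in S) y i ^+ 2 = 0 by [].
  move=> /(_ (fun i _ => sqr_ge0 _))/(_ i iS)/eqP; rewrite sqrf_eq0 => /eqP ->.
  by rewrite !mul0r.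
have {n2n0}n2gt0 : 0 < n2 by rewrite lt_def n2n0.
(* This [s] balances the two halves of the weighted bound: [s * (n2 ^+ 2 * D / #|S|)] equals
   [t * n2], and [K / s <= t * n2] is the energy hypothesis. *)
pose s := #|S|%:R * t / (D * n2).
have s0 : 0 < s by rewrite /s divr_gt0 ?mulr_gt0.
rewrite big_sym_pairs; last by move=> i j; rewrite Ws [y i * _]mulrC.
have step : 2 * \sum_(e in pairs S) (if e.1 == e.2 then 1 else 2) *
      (y e.1 * y e.2 * W e.1 e.2) <=
    s * (\sum_(e in pairs S) (if e.1 == e.2 then 1 else 2) *
      (if e.1 == e.2 then eta * y e.1 ^+ 4 else 2 * (y e.1 ^+ 2 * y e.2 ^+ 2))) + K / s.
  rewrite mulr_sumr [s * _]mulr_sumr mulr_suml -big_split/=.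
  apply: ler_sum => e eS.
  have := @weighted_amgm (if e.1 == e.2 then 1 else 2) (y e.1 * y e.2) (W e.1 e.2)
    (entry_var e) (k e) s (entry_var_ge0 e) (k0 e eS) s0 (Wk e eS).
  move=> /le_trans; apply; rewrite lerD2r ler_wpM2l ?(ltW s0)// /entry_var.
  by case: eqP => [<-|_]; rewrite le_eqVlt; apply/orP; left; apply/eqP; ring.
have varE : \sum_(e in pairs S) (if e.1 == e.2 then 1 else 2) *
    (if e.1 == e.2 then eta * y e.1 ^+ 4 else 2 * (y e.1 ^+ 2 * y e.2 ^+ 2)) =
    (* The sum over pairs is evaluated by folding it back into a double sum over [S]. *)
    2 * n2 ^+ 2 - (2 - eta) * \sum_(i in S) y i ^+ 4.
  rewrite -(@big_sym_pairs _ R S (fun i j =>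
    if i == j then eta * y i ^+ 4 else 2 * (y i ^+ 2 * y j ^+ 2))); last first.
    by move=> i j; rewrite eq_sym; case: eqP => [->//|_]; rewrite [y i ^+ 2 * _]mulrC.
  rewrite expr2 {1}/n2 mulr_suml !mulr_sumr -sumrB; apply: eq_bigr => i iS.
  rewrite (bigD1 i)//= eqxx mulrA mulr_sumr [in RHS](bigD1 i)//=.
  rewrite [X in _ + X = _](eq_bigr (fun j => 2 * y i ^+ 2 * y j ^+ 2)); last first.
    by move=> j /andP[_ ji]; rewrite eq_sym (negbTE ji) mulrA.
  ring.
have var_le : 2 * n2 ^+ 2 - (2 - eta) * \sum_(i in S) y i ^+ 4 <= n2 ^+ 2 * D / #|S|%:R.
  have q := @sum_quartic_ge _ S y (ltnW S1).
  have q2 : (2 - eta) * (n2 ^+ 2 / #|S|%:R) <= (2 - eta) * \sum_(i in S) y i ^+ 4.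
    by apply: ler_wpM2l => //; lra.
  have -> : n2 ^+ 2 * D / #|S|%:R = 2 * n2 ^+ 2 - (2 - eta) * (n2 ^+ 2 / #|S|%:R).
    by rewrite /D; field; rewrite gt_eqF.
  lra.
have h1 : s * (n2 ^+ 2 * D / #|S|%:R) = t * n2.
  by rewrite /s; field; rewrite !gt_eqF.
have h2 : K / s <= t * n2.
  rewrite ler_pdivrMr// /s [leRHS](_ : _ = #|S|%:R * t ^+ 2 / D); last first.
    by field; rewrite !gt_eqF.
  by rewrite ler_pdivlMr// mulrC.
rewrite varE in step.
have := ler_wpM2l (ltW s0) var_le; rewrite h1 => h3.
lra.
Qed.

(** [k] acts as the integer part of w^2 / v truncated at [M], which leaves finitely many levels to
    sum over. When [v = 0], a nonzero [w] climbs to level [M]. *)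
Lemma tail_level (w v : R) (M : nat) : 0 <= v ->
  exists2 k, (k <= M)%N & tail_set v k w /\ (k = M \/ w ^+ 2 <= v * (k.+1)%:R).
Proof.
move=> v0; elim: M => [|M [k kM [tk kP]]].
  by exists 0%N => //; split; [rewrite /tail_set|left].
case: kP => [kE|wk]; last by exists k; [rewrite leqW|split=> //; right].
have [tM|] := boolP ((w != 0) && (M.+1%:R * v <= w ^+ 2)).
  by exists M.+1 => //; split; [exact: tM|left].
rewrite negb_and negbK => ntM; exists M => //; split; first by rewrite -kE.
right; move: ntM => /orP[/eqP ->|]; first by rewrite expr0n mulr_ge0.
by rewrite -ltNge mulrC => /ltW.
Qed.

End energy_bound.

Section union_bound.
Context d (T : measurableType d) (R : realType) (P : probability T R).

Lemma probability_bigsetU_le (I : Type) (r : seq I) (Q : pred I) (F : I -> set T) :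
  (forall i, measurable (F i)) ->
  (P (\big[setU/set0]_(i <- r | Q i) F i) <= \sum_(i <- r | Q i) P (F i))%E.
Proof.
move=> mF; elim: r => [|i r ih]; first by rewrite !big_nil measure0.
rewrite !big_cons; case: ifP => // _.
apply: le_trans (leeD2l _ ih); apply: measureU2 => //.
by elim/big_ind : _ => // A B; exact: measurableU.
Qed.

Lemma probability_le_sum (I : finType) (Q : pred I) (A : set T) (F : I -> set T) :
  measurable A -> (forall i, measurable (F i)) ->
  (forall x, A x -> exists2 i, Q i & F i x) ->
  (P A <= \sum_(i | Q i) P (F i))%E.
Proof.
move=> mA mF AF; apply: le_trans (probability_bigsetU_le _ _ mF).
apply: le_measure; rewrite ?inE//.
  by elim/big_ind : _ => // B C; exact: measurableU.
by move=> x /AF[i Qi Fi]; rewrite (bigD1 i)//=; left.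
Qed.

End union_bound.

Lemma bin_le_exp n k : ('C(n, k) <= n ^ k)%N.
Proof.
apply: (@leq_trans (n ^_ k)); first by rewrite -bin_ffact leq_pmulr// fact_gt0.
by elim: k => // k ih; rewrite ffactnSr expnSr leq_mul// leq_subr.
Qed.

Lemma geometric_sum_le (R : realFieldType) (r : R) n : 0 <= r < 1 ->
  \sum_(i < n) r ^+ i <= (1 - r)^-1.
Proof.
move=> /andP[r0 r1]; have r1' : 0 < 1 - r by rewrite subr_gt0.
rewrite -(ler_pM2l r1') divff ?gt_eqF//.
have := subrX1 r n; have := exprn_ge0 n r0; nra.
Qed.

(** * Tail bound for the maximum from above *)

Section upper_probability.
Context d (T : measurableType d) (R : realType) (P : probability T R).
Variables (eta : R) (p : nat) (w : 'I_p -> 'I_p -> {RV P >-> R}).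
Hypotheses (heta : 0 <= eta <= 2) (hw : gaussian_symmetric_matrix eta w).

Lemma entry_law (e : 'I_p * 'I_p) (B : set R) : (e.1 <= e.2)%N -> measurable B ->
  P (w e.1 e.2 @^-1` B) = centered_gaussian (entry_var eta e) B.
Proof.
move=> le mB; rewrite /entry_var; case: eqP => [->|ne].
  by rewrite -(gsm_diag hw e.2 mB).
rewrite -(@gsm_offdiag _ _ _ _ _ _ _ hw e.1 e.2 B)// ltn_neqAle le andbT.
by apply/eqP => /val_inj.
Qed.

Lemma box_law (J : {set 'I_p * 'I_p}) (B : 'I_p * 'I_p -> set R) :
  (forall e, e \in J -> (e.1 <= e.2)%N) -> (forall e, measurable (B e)) ->
  P (\bigcap_(e in [set` J]) (w e.1 e.2 @^-1` B e)) =
  (\prod_(e in J) centered_gaussian (entry_var eta e) (B e))%E.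
Proof.
move=> leJ mB; rewrite (gsm_indep hw)//; last first.
  by apply/fintype.subsetP => e eJ; rewrite inE leJ.
by apply: eq_bigr => e eJ; rewrite entry_law// leJ.
Qed.

Lemma centered_gaussian_ge0 (v : R) B : (0 <= centered_gaussian v B)%E.
Proof. by rewrite /centered_gaussian; case: ifP => _; exact: measure_ge0. Qed.

Lemma centered_gaussian_fineK (v : R) B : measurable B ->
  ((fine (centered_gaussian v B))%:E = centered_gaussian v B)%E.
Proof.
move=> mB; rewrite fineK// ge0_fin_numE ?centered_gaussian_ge0//.
by rewrite (le_lt_trans (centered_gaussian_le1 v mB))// ltry.
Qed.

Lemma box_lawE (J : {set 'I_p * 'I_p}) (B : 'I_p * 'I_p -> set R) :
  (forall e, e \in J -> (e.1 <= e.2)%N) -> (forall e, measurable (B e)) ->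
  P (\bigcap_(e in [set` J]) (w e.1 e.2 @^-1` B e)) =
  (\prod_(e in J) fine (centered_gaussian (entry_var eta e) (B e)))%:E.
Proof.
move=> leJ mB; rewrite box_law// -prodEFin; apply: eq_bigr => e _.
by rewrite centered_gaussian_fineK.
Qed.

Lemma measurable_box (J : {set 'I_p * 'I_p}) (B : 'I_p * 'I_p -> set R) :
  (forall e, measurable (B e)) ->
  measurable (\bigcap_(e in [set` J]) (w e.1 e.2 @^-1` B e)).
Proof.
move=> mB; apply: fin_bigcap_measurable => // e _.
by rewrite -[X in measurable X]setTI; exact: measurable_funP.
Qed.

Variables (th th1 : R).
Hypotheses (hth : 0 <= th < th1) (hth1 : th1 < 2^-1).

(* Bounds the exponential moment, at parameter th, of 1 + floor(g^2) for a
   standard Gaussian g, via the tail bound at parameter th1 > th. *)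
Definition chi_const := (Num.sqrt (1 - 2 * th1))^-1 * expR th / (1 - expR (- (th1 - th))).

(** Allows the exponent to be raised from the number of pairs to [m ^ 2]. *)
Lemma chi_const_ge1 : 1 <= chi_const.
Proof.
have /andP[th0 tht] := hth; have th12 := hth1.
have e1 : expR (- (th1 - th)) < 1 by rewrite -expR0 ltr_expR; lra.
have e0 : 0 < expR (- (th1 - th)) := expR_gt0 _.
rewrite /chi_const ler_pdivlMr ?subr_gt0// mul1r.
have e2 : 1 <= expR th by rewrite -expR0 ler_expR.
have s0 : 0 < Num.sqrt (1 - 2 * th1) by rewrite sqrtr_gt0; lra.
have s1 : 1 <= (Num.sqrt (1 - 2 * th1))^-1.
  by rewrite invf_ge1// -[leRHS]sqrtr1 ler_sqrt//; lra.
have := ler_pM ler01 ler01 s1 e2; lra.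
Qed.

Lemma box_tail (J : {set 'I_p * 'I_p}) (k : 'I_p * 'I_p -> nat) :
  (forall e, e \in J -> (e.1 <= e.2)%N) ->
  (P (\bigcap_(e in [set` J]) (w e.1 e.2 @^-1` tail_set (entry_var eta e) (k e))) <=
   (\prod_(e in J) ((Num.sqrt (1 - 2 * th1))^-1 * expR (- (th1 * (k e)%:R))))%:E)%E.
Proof.
move=> leJ; rewrite box_lawE//; last by move=> e; exact: measurable_tail_set.
rewrite lee_fin; apply: ler_prod => e _.
rewrite fine_ge0 ?centered_gaussian_ge0//= -lee_fin centered_gaussian_fineK; last exact: measurable_tail_set.
apply: gaussian_tail; last exact: entry_var_ge0.
by have /andP[th0 tht] := hth; have th12 := hth1; apply/andP; split => //; lra.
Qed.

(** Under the constraint, the factor exp(th (sum - u)) is at least 1. Once it is inserted, the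
    constraint is dropped and the sum factors into one geometric series of ratio exp(-(th1 - th))
    per entry. [pffun_on] fixes the levels outside [J], so that each assignment counts once. *)
Lemma sum_box_tail (J : {set 'I_p * 'I_p}) (M : nat) (u : R) :
  \sum_(k in pffun_on (ord0 : 'I_M.+1) (mem J) predT |
      u <= \sum_(e in J) (k e).+1%:R)
    \prod_(e in J) ((Num.sqrt (1 - 2 * th1))^-1 * expR (- (th1 * (k e)%:R))) <=
  expR (- (th * u)) * chi_const ^+ #|J|.
Proof.
have /andP[th0 tht] := hth; have th12 := hth1.
set c := (Num.sqrt (1 - 2 * th1))^-1.
have c0 : 0 <= c by rewrite invr_ge0 sqrtr_ge0.
pose g (k : 'I_M.+1) := c * expR th * expR (- (th1 - th)) ^+ k.
have g0 k : 0 <= g k by rewrite /g !mulr_ge0 ?exprn_ge0 ?expR_ge0.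
apply: (@le_trans _ _ (\sum_(k in pffun_on (ord0 : 'I_M.+1) (mem J) predT)
    expR (- (th * u)) * \prod_(e in J) g (k e))).
  rewrite [leRHS](bigID (fun k : {ffun 'I_p * 'I_p -> 'I_M.+1} => u <= \sum_(e in J) (k e).+1%:R))/=.
  rewrite -[leLHS]addr0 lerD//; last first.
    by apply: sumr_ge0 => k _; rewrite mulr_ge0 ?expR_ge0// prodr_ge0.
  apply: ler_sum => k /andP[_ ku].
  have -> : \prod_(e in J) g (k e) = expR (th * \sum_(e in J) (k e).+1%:R) *
      \prod_(e in J) (c * expR (- (th1 * (k e)%:R))).
    rewrite mulr_sumr expR_sum -big_split/=; apply: eq_bigr => e _.
    rewrite /g -expRM_natl -!mulrA [RHS]mulrCA; congr (_ * _).
    by rewrite -!expRD; congr expR; rewrite -natr1; ring.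
  rewrite mulrA -expRD ler_peMl//.
    by apply: prodr_ge0 => e _; rewrite mulr_ge0 ?expR_ge0.
  rewrite -[leLHS]expR0 ler_expR addrC -mulrBr mulr_ge0// subr_ge0.
  exact: ku.
rewrite -mulr_sumr ler_wpM2l ?expR_ge0//.
have := big_distr_big (ord0 : 'I_M.+1) (mem J) predT (fun _ k => g k) => <-.
rewrite -prodr_const; apply: ler_prod => e _; rewrite sumr_ge0//=.
rewrite -mulr_sumr /chi_const ler_wpM2l ?mulr_ge0 ?expR_ge0//.
apply: geometric_sum_le; rewrite expR_ge0/= -expR0 ltr_expR; lra.
Qed.

(** If the maximum exceeds [t], the energy criterion fails for some [S], so the rounded-up levels of
    its entries sum to at least [u]. A union bound over sets and levels follows; [sum_box_tail]
    treats the levels, and at most [p ^ m] sets remain. *)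
Lemma Ttilde_upper_tail (m : nat) (t : R) : (2 <= m <= p)%N -> 0 < t ->
  (P [set omega | (t < Ttilde m w omega)%R] <=
   (p%:R ^+ m * (expR (- (th * (m%:R * t ^+ 2 / (2 * (m%:R - 1) + eta)))) *
     chi_const ^+ (m ^ 2)))%:E)%E.
Proof.
move=> /andP[m2 mp] t0; have /andP[eta0 eta2] := heta.
have mp' : (0 < m <= p)%N by rewrite mp andbT ltnW.
set D := 2 * (m%:R - 1) + eta; set u := m%:R * t ^+ 2 / D.
have m1 : 1 < m%:R :> R by rewrite ltr1n.
have D0 : 0 < D by rewrite /D; lra.
have u0 : 0 <= u by rewrite divr_ge0 ?(ltW D0)// mulr_ge0// sqr_ge0.
(* Truncation above [u] is harmless: one entry at level [M] already brings the sum to [u]. *)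
pose M := Num.bound u.
have uM : u < M%:R by rewrite /M archi_boundP.
pose K : finType := {ffun 'I_p * 'I_p -> 'I_M.+1}.
pose F (i : {set 'I_p} * K) : set T :=
  \bigcap_(e in [set` pairs i.1]) (w e.1 e.2 @^-1` tail_set (entry_var eta e) (i.2 e)).
pose Q (i : {set 'I_p} * K) := (#|i.1| == m) &&
  ((i.2 \in pffun_on (ord0 : 'I_M.+1) (mem (pairs i.1)) predT) &&
   (u <= \sum_(e in pairs i.1) (i.2 e).+1%:R)).
have mF i : measurable (F i) by apply: measurable_box => e; exact: measurable_tail_set.
have mT : measurable [set omega | t < Ttilde m w omega].
  rewrite (_ : mkset _ = setT `&` Ttilde m w @^-1` `]t, +oo[); last first.
    by rewrite setTI; apply/seteqP; split=> omega /=; rewrite in_itv/= andbT.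
  by apply: measurable_Ttilde => //; exact: (gsm_sym hw).
apply: (@le_trans _ _ (\sum_(i | Q i) P (F i))%E).
  apply: probability_le_sum => // omega /= tT.
  have : ~ (Ttilde m w omega <= t) by apply/negP; rewrite -ltNge.
  rewrite (Ttilde_leP (gsm_sym hw) mp').
  move=> /existsNP[S /not_implyP[Sm nS]].
  have /choice[k kP] e : exists k, [/\ (k <= M)%N,
      tail_set (entry_var eta e) k (w e.1 e.2 omega) &
      k = M \/ w e.1 e.2 omega ^+ 2 <= entry_var eta e * k.+1%:R].
    have [k kM [? ?]] := tail_level (w e.1 e.2 omega) M (entry_var_ge0 heta e).
    by exists k.
  pose kk : K := [ffun e => if e \in pairs S then inord (k e) else ord0].
  have kkE e : e \in pairs S -> kk e = k e :> nat.
    by move=> eS; rewrite ffunE eS inordK// ltnS; case: (kP e).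
  exists (S, kk); last first.
    by move=> e /= eS; rewrite kkE//; have [] := kP e.
  rewrite /Q/= Sm eqxx/=; apply/andP; split.
    apply/pffun_onP; split=> [|? //].
    by apply/supportP => e eS; rewrite ffunE (negbTE eS).
  rewrite leNgt; apply/negP => ltu; apply: nS => y.
  have kM e : e \in pairs S -> w e.1 e.2 omega ^+ 2 <= entry_var eta e * (kk e).+1%:R.
    move=> eS; rewrite kkE//; have [_ _ [kE|//]] := kP e.
    exfalso; move: ltu; apply/negP; rewrite -leNgt.
    rewrite (bigD1 e)//= kkE// kE (le_trans (ltW uM))//.
    by rewrite -natr1 -addrA lerDl addr_ge0// sumr_ge0.
  apply: (form_le_of_energy heta (k := fun e => (kk e).+1%:R)) => //.
  - by rewrite Sm.
  - by move=> i j; exact: (gsm_sym hw).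
  - by move: ltu => /ltW; rewrite /u ler_pdivlMr// Sm mulrC.
apply: (@le_trans _ _ (\sum_(i | Q i) (\prod_(e in pairs i.1)
    ((Num.sqrt (1 - 2 * th1))^-1 * expR (- (th1 * (i.2 e)%:R))))%:E)%E).
  by apply: lee_sum => i _; apply: box_tail => e /pairsP[].
rewrite sumEFin lee_fin -(pair_big_dep (fun S : {set 'I_p} => #|S| == m)
  (fun S (k : K) => (k \in pffun_on (ord0 : 'I_M.+1) (mem (pairs S)) predT) &&
   (u <= \sum_(e in pairs S) (k e).+1%:R))
  (fun S (k : K) => \prod_(e in pairs S)
    ((Num.sqrt (1 - 2 * th1))^-1 * expR (- (th1 * (k e)%:R))))).
apply: (@le_trans _ _ (\sum_(S : {set 'I_p} | #|S| == m)
    (expR (- (th * u)) * chi_const ^+ (m ^ 2)))).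
  apply: ler_sum => S /eqP Sm; apply: le_trans (sum_box_tail _ _ _) _.
  rewrite ler_wpM2l ?expR_ge0// ler_weXn2l ?chi_const_ge1//.
  by rewrite -Sm card_pairs_le.
rewrite sumr_const -[leLHS]mulr_natl ler_wpM2r//.
  by rewrite mulr_ge0 ?expR_ge0// exprn_ge0// (le_trans _ chi_const_ge1).
rewrite -natrX ler_nat -[X in (_ <= X ^ _)%N](card_ord p).
have := card_draws 'I_p m; rewrite cardsE => ->.
exact: bin_le_exp.
Qed.

End upper_probability.

(** * Lower bound *)

Lemma big_option (R : nmodType) (I : finType) (F : option I -> R) :
  \sum_i F i = F None + \sum_i F (Some i).
Proof.
rewrite (bigD1 None)//=; congr (_ + _).
by rewrite (reindex_omap Some id)/=; [apply: eq_bigl => i; rewrite eqxx|case].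
Qed.

(** * The second moment method for finitely many events *)

Section second_moment.
Context d (T : measurableType d) (R : realType) (P : probability T R).

Lemma integral_indic_comb (I : finType) (c : I -> R) (A : I -> set T) :
  (forall i, 0 <= c i) -> (forall i, measurable (A i)) ->
  (\int[P]_omega (\sum_i c i * \1_(A i) omega)%:E =
    (\sum_i c i * fine (P (A i)))%:E)%E.
Proof.
move=> c0 mA; under eq_integral do rewrite -sumEFin.
rewrite ge0_integral_sum//; last 2 first.
- by move=> i; apply/measurable_EFinP; apply: measurable_funM.
- by move=> i omega _; rewrite lee_fin mulr_ge0.
rewrite -sumEFin; apply: eq_bigr => i _; under eq_integral do rewrite EFinM.
rewrite ge0_integralZl//; last 2 first.
- by apply/measurable_EFinP; exact: measurable_indic.
- by rewrite lee_fin.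
by rewrite integral_indic// setIT EFinM fineK// fin_num_measure.
Qed.

Lemma indic_comb_le (I J : finType) (c : I -> R) (A : I -> set T)
    (e : J -> R) (B : J -> set T) :
  (forall i, 0 <= c i) -> (forall i, measurable (A i)) ->
  (forall j, 0 <= e j) -> (forall j, measurable (B j)) ->
  (forall omega, \sum_i c i * \1_(A i) omega <= \sum_j e j * \1_(B j) omega) ->
  \sum_i c i * fine (P (A i)) <= \sum_j e j * fine (P (B j)).
Proof.
move=> c0 mA e0 mB AB; rewrite -lee_fin -!integral_indic_comb//.
have m1 (K : finType) (a : K -> R) (C : K -> set T) : (forall k, measurable (C k)) ->
    measurable_fun setT (fun omega => (\sum_k a k * \1_(C k) omega)%:E).
  move=> mC; apply/measurable_EFinP; apply: measurable_sum => k.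
  exact: measurable_funM.
apply: ge0_le_integral => //.
- by move=> omega _; rewrite lee_fin sumr_ge0// => i _; rewrite mulr_ge0.
- exact: m1.
- exact: m1.
- by move=> omega _; rewrite lee_fin.
Qed.

(* Second moment of the weighted count Z = sum_i 1_(E i) / P (E i), whose mean
   is N = #|I|: integrate N^2 1_(Z = 0) + 2 N Z <= Z^2 + N^2. *)
Lemma second_moment_bound (I : finType) (E : I -> set T) (b : I -> I -> R) :
  (0 < #|I|)%N ->
  (forall i, measurable (E i)) -> (forall i, 0 < fine (P (E i))) ->
  (forall i j, fine (P (E i `&` E j)) = fine (P (E i)) * fine (P (E j)) * b i j) ->
  fine (P (~` \bigcup_i E i)) <=
    (\sum_i \sum_j b i j) / #|I|%:R ^+ 2 - 1.
Proof.
move=> I0 mE PE PEE; set N : R := #|I|%:R.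
have N0 : 0 < N by rewrite ltr0n.
(* [None] carries the constant [N ^+ 2], on the event [Z = 0] and on the whole space; [Some] carries
   the terms of [2 N Z] and of [Z ^+ 2]. *)
pose c (i : option I) : R := if i is Some i then 2 * N / fine (P (E i)) else N ^+ 2.
pose A (i : option I) : set T := if i is Some i then E i else ~` \bigcup_i E i.
pose e (i : option (I * I)) : R :=
  if i is Some (i, j) then (fine (P (E i)) * fine (P (E j)))^-1 else N ^+ 2.
pose B (i : option (I * I)) : set T := if i is Some (i, j) then E i `&` E j else setT.
have mU : measurable (~` \bigcup_i E i).
  by apply: measurableC; apply: fin_bigcup_measurable => // i _.
have key : \sum_i c i * fine (P (A i)) <= \sum_i e i * fine (P (B i)).
  apply: indic_comb_le.
  - case=> [i|]; last exact: sqr_ge0.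
    by rewrite /= divr_ge0 ?(ltW (PE _))// mulr_ge0// ltW.
  - by case.
  - case=> [[i j]|]; last exact: sqr_ge0.
    by rewrite /= invr_ge0 mulr_ge0// ltW.
  - by case=> [[i j]|] //=; exact: measurableI.
  move=> omega; rewrite !big_option/= indicT mulr1.
  pose z i : R := \1_(E i) omega / fine (P (E i)).
  have -> : \sum_i 2 * N / fine (P (E i)) * \1_(E i) omega = 2 * N * \sum_i z i.
    by rewrite mulr_sumr; apply: eq_bigr => i _; rewrite /z -!mulrA [_^-1 * _]mulrC.
  have -> : \sum_i e (Some i) * \1_(B (Some i)) omega = (\sum_i z i) ^+ 2.
    rewrite expr2 mulr_suml; under [RHS]eq_bigr do rewrite mulr_sumr.
    rewrite pair_bigA/=; apply: eq_bigr => -[i j] _ /=.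
    by rewrite indicI /z invfM /=; ring.
  (* If no event occurs, both sides equal [N ^+ 2]; otherwise the claim is [(Z - N) ^+ 2 >= 0]. *)
  have [nE|/contrapT[i _ Ei]] := pselect ((~` \bigcup_i E i) omega).
    rewrite indicE mem_set// mulr1 big1 ?mulr0 ?expr0n/= ?addr0//.
    by move=> i _; rewrite /z indicE memNset ?mul0r// => Ei; apply: nE; exists i.
  rewrite indicE memNset ?mulr0 ?add0r; last by move=> /(_ _); apply; exists i.
  have := sqr_ge0 (\sum_i z i - N); nra.
move: key; rewrite !big_option/= probability_setT/= mulr1.
have -> : \sum_i 2 * N / fine (P (E i)) * fine (P (E i)) = 2 * N * N.
  rewrite (eq_bigr (fun=> 2 * N)) => [|i _]; last by rewrite divfK// gt_eqF.
  by rewrite sumr_const -[LHS]mulr_natr.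
have -> : \sum_i e (Some i) * fine (P (B (Some i))) = \sum_i \sum_j b i j.
  rewrite pair_bigA/=; apply: eq_bigr => -[i j] _ /=.
  by rewrite PEE mulrA mulVf ?mul1r// mulf_neq0// gt_eqF.
move=> h; rewrite lerBrDr ler_pdivlMr ?exprn_gt0//; nra.
Qed.

End second_moment.

(** * Index sets with one element in each block *)

Section block_sets.
Variables (p m L : nat).
Hypothesis mLp : (m * L <= p)%N.

Lemma block_subproof (i : 'I_m) (a : 'I_L) : (i * L + a < p)%N.
Proof.
apply: leq_trans mLp; apply: (@leq_trans (i * L + L)); first by rewrite ltn_add2l.
by rewrite -mulSnr leq_mul2r ltn_ord orbT.
Qed.

Definition block_elt i a : 'I_p := Ordinal (block_subproof i a).

Lemma block_elt_inj i a j b : block_elt i a = block_elt j b -> i = j /\ a = b.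
Proof.
move=> /(congr1 val) /= e; have L0 : (0 < L)%N := leq_ltn_trans (leq0n a) (ltn_ord a).
have ij : i = j :> nat.
  by have := congr1 (divn^~ L) e; rewrite !divnMDl// !divn_small// !addn0.
by split; apply: val_inj => //=; move: e; rewrite ij => /addnI.
Qed.

(** Coding the sets by functions gives the family a product structure, so that sums over pairs of
    sets factor over blocks. *)
Definition block_set (f : {ffun 'I_m -> 'I_L}) : {set 'I_p} :=
  [set block_elt i (f i) | i : 'I_m]%SET.

Lemma card_block_set f : #|block_set f| = m.
Proof. by rewrite card_imset ?card_ord// => i j /block_elt_inj[]. Qed.

(** A common element determines its block and its position there, so it comes from an index where
    [f] and [g] agree. *)
Lemma card_block_setI f g :
  (#|block_set f :&: block_set g| <= \sum_i (f i == g i))%N.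
Proof.
rewrite -sum1dep_card -(@big_mkcond _ _ _ _ _ (fun i => f i == g i) (fun=> 1%N))/=.
rewrite !sum1dep_card.
apply: leq_trans (leq_imset_card (fun i => block_elt i (f i)) _).
apply/subset_leq_card/fintype.subsetP => x /setIP[/imsetP[i _ ->] /imsetP[j _]].
move=> /block_elt_inj[ij fg]; apply/imsetP; exists i => //.
by rewrite inE fg ij.
Qed.

End block_sets.

(** For fixed [f] the sum over [g] factors over coordinates: one value agrees and contributes [G],
    the other [L - 1] contribute 1. *)
Lemma sum_agreement (R : comNzRingType) (m L : nat) (G : R) :
  \sum_(f : {ffun 'I_m -> 'I_L}) \sum_(g : {ffun 'I_m -> 'I_L})
    G ^+ (\sum_i (f i == g i))%N = L%:R ^+ m * (L%:R - 1 + G) ^+ m.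
Proof.
rewrite (eq_bigr (fun=> (L%:R - 1 + G) ^+ m)) => [|f _].
  by rewrite sumr_const card_ffun !card_ord -[LHS]mulr_natl natrX.
under eq_bigr do rewrite -prodrXr.
rewrite -(bigA_distr_bigA (fun i b => G ^+ (f i == b)))/=.
rewrite (eq_bigr (fun=> L%:R - 1 + G)) ?prodr_const ?card_ord// => i _.
rewrite (bigD1 (f i))//= eqxx expr1 addrC; congr (_ + _).
rewrite (eq_bigr (fun=> 1)) => [|b]; last by rewrite eq_sym => /negbTE ->.
have L0 : (0 < L)%N := leq_ltn_trans (leq0n _) (ltn_ord (f i)).
by rewrite sumr_const cardC1 card_ord -[in RHS](prednK L0) -natr1 addrK.
Qed.

Lemma sum_diag_const (R : comNzRingType) (I : finType) (S : {set I}) (a b : R) :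
  \sum_(i in S) \sum_(j in S) (if i == j then a else b) =
  #|S|%:R * (a + (#|S|%:R - 1) * b).
Proof.
rewrite (eq_bigr (fun=> a + (#|S|%:R - 1) * b)) => [|i iS].
  by rewrite sumr_const mulr_natl.
rewrite (bigD1 i)//= eqxx; congr (_ + _).
rewrite (eq_bigr (fun=> b)) => [|j /andP[_]]; last by rewrite eq_sym => /negbTE ->.
rewrite sumr_const -[LHS]mulr_natl; congr (_ * _).
rewrite (cardD1 i S) iS natrD addrC addKr; congr (_ %:R).
by apply: eq_card => b'; rewrite !inE andbC.
Qed.

(** * Tail bound for the maximum from below *)

Section lower_probability.
Context d (T : measurableType d) (R : realType) (P : probability T R).
Variables (eta : R) (p : nat) (w : 'I_p -> 'I_p -> {RV P >-> R}).
Hypothesis hw : gaussian_symmetric_matrix eta w.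
Variables (m L : nat) (lam al be : R).
Hypotheses (m1 : (1 < m)%N) (L0 : (0 < L)%N) (mLp : (m * L <= p)%N).
Hypotheses (al0 : 0 <= al) (be0 : 0 <= be).
Hypotheses (off_ge : expR (- al) <= fine (centered_gaussian 1 `[2 * lam, +oo[))
  (diag_ge : expR (- be) <= fine (centered_gaussian eta `[eta * lam, +oo[)).

(** Thresholds are proportional to weight times variance of the entry in the flat quadratic form,
    the cheapest profile for a given value of that form. *)
Let thr (e : 'I_p * 'I_p) : R := if e.1 == e.2 then eta * lam else 2 * lam.

Let B e : set R := `[thr e, +oo[.

Let rho e : R := fine (centered_gaussian (entry_var eta e) (B e)).

Let cost (e : 'I_p * 'I_p) : R := if e.1 == e.2 then be else al.

(** Cost per index of a set of size [m], each off-diagonal cost being shared by its two indices. *)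
Let gam := be + (m%:R - 1) * (al / 2).

Let rho_ge e : expR (- cost e) <= rho e.
Proof. by rewrite /cost /rho /B /thr /entry_var; case: ifP. Qed.

Let rho_gt0 e : 0 < rho e.
Proof. exact: lt_le_trans (expR_gt0 _) (rho_ge e). Qed.

(** The total cost [|K| (be + (|K| - 1) al / 2)] is replaced by a bound linear in [|K|], which lets
    the second moment factor over blocks. *)
Let pairs_prod_ge (K : {set 'I_p}) : (#|K| <= m)%N ->
  expR (- (#|K|%:R * gam)) <= \prod_(e in pairs K) rho e.
Proof.
move=> Km; apply: (@le_trans _ _ (\prod_(e in pairs K) expR (- cost e))); last first.
  by apply: ler_prod => e _; rewrite expR_ge0/=.
rewrite -expR_sum ler_expR sumrN lerN2.
have -> : \sum_(e in pairs K) cost e =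
    \sum_(i in K) \sum_(j in K) (if i == j then be else al / 2).
  rewrite big_sym_pairs => [|i j]; last by rewrite eq_sym.
  by apply: eq_bigr => e _; rewrite /cost; case: ifP => _; [rewrite mul1r|field].
rewrite sum_diag_const ler_wpM2l// lerD2l ler_wpM2r ?divr_ge0//.
by rewrite lerD2r ler_nat.
Qed.

Let E (f : {ffun 'I_m -> 'I_L}) : set T :=
  \bigcap_(e in [set` pairs (block_set mLp f)]) (w e.1 e.2 @^-1` B e).

Let mB e : measurable (B e). Proof. exact: measurable_itv. Qed.

Let PE f : fine (P (E f)) = \prod_(e in pairs (block_set mLp f)) rho e.
Proof. by rewrite /E (box_lawE hw)// => e /pairsP[]. Qed.

(** The joint event constrains the union of the two sets of pairs; the product of probabilities
    counts the shared pairs twice, and the inverse factor corrects this. *)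
Let PEE f g : fine (P (E f `&` E g)) = fine (P (E f)) * fine (P (E g)) *
  (\prod_(e in pairs (block_set mLp f :&: block_set mLp g)) rho e)^-1.
Proof.
set Sf := block_set mLp f; set Sg := block_set mLp g.
have -> : E f `&` E g =
    \bigcap_(e in [set` pairs Sf :|: pairs Sg]) (w e.1 e.2 @^-1` B e).
  apply/seteqP; split=> omega.
    by move=> [Ef Eg] e /=; rewrite inE => /orP[]; [exact: Ef|exact: Eg].
  by move=> h; split=> e /= eS; apply: h; rewrite /= inE eS ?orbT.
rewrite (box_lawE hw)//=; last by move=> e; rewrite inE => /orP[] /pairsP[].
rewrite !PE -/Sf -/Sg.
have -> : pairs (Sf :&: Sg) = (pairs Sf :&: pairs Sg)%SET.
  apply/setP => e; rewrite !inE.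
  case: (e.1 \in Sf); case: (e.2 \in Sf); case: (e.1 \in Sg) => //;
  by case: (e.2 \in Sg); case: (_ <= _)%N.
rewrite (big_setID (pairs Sf))/= finset.setUK.
rewrite [X in _ = _ * X / _](big_setID (pairs Sf))/=.
have -> : ((pairs Sf :|: pairs Sg) :\: pairs Sf = pairs Sg :\: pairs Sf)%SET.
  by rewrite finset.setDUl finset.setDv finset.set0U.
have n0 : \prod_(e in (pairs Sg :&: pairs Sf)%SET) rho e != 0.
  by rewrite gt_eqF// prodr_gt0.
by rewrite [(pairs Sf :&: pairs Sg)%SET]finset.setIC; field.
Qed.

(** If any [E f] occurs, the flat vector gives the desired lower bound. The second moment method
    bounds the probability that none occurs, with correlation ratios at most [expR gam] to the
    number of agreements. *)
Lemma Ttilde_lower_tail :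
  (P [set omega | (Ttilde m w omega < lam * (2 * (m%:R - 1) + eta))%R] <=
    ((1 + (expR gam - 1) / L%:R) ^+ m - 1)%:E)%E.
Proof.
have mp : (0 < m <= p)%N.
  by rewrite (ltnW m1)/= (leq_trans _ mLp)// leq_pmulr.
have L0' : 0 < L%:R :> R by rewrite ltr0n.
have m0 : 0 < m%:R :> R by rewrite ltr0n ltnW.
have mE f : measurable (E f) by exact: measurable_box.
have mU : measurable (~` \bigcup_f E f).
  by apply: measurableC; apply: fin_bigcup_measurable.
have mT : measurable [set omega | Ttilde m w omega < lam * (2 * (m%:R - 1) + eta)].
  rewrite (_ : mkset _ = setT `&` Ttilde m w @^-1`
      `]-oo, (lam * (2 * (m%:R - 1) + eta))[); last first.
    by rewrite setTI; apply/seteqP; split=> omega /=; rewrite in_itv.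
  by apply: measurable_Ttilde => //; exact: (gsm_sym hw).
apply: (@le_trans _ _ (P (~` \bigcup_f E f))).
  apply: le_measure; rewrite ?inE// => omega /= Tl [f _ Ef].
  move: Tl; apply/negP; rewrite -leNgt.
  have := lexx (Ttilde m w omega); rewrite (Ttilde_leP (gsm_sym hw) mp).
  (* The flat test vector: its form is the sum of all entries of the submatrix, its squared norm is
     [m]. *)
  move=> /(_ _ (card_block_set mLp f) (fun=> 1)).
  set S := block_set mLp f.
  rewrite [X in _ <= _ * X](eq_bigr (fun=> 1)) => [|i _]; last by rewrite expr1n.
  rewrite sumr_const card_block_set => h.
  rewrite -(ler_pM2r m0); apply: le_trans h.
  rewrite (eq_bigr (fun i => \sum_(j in S) w i j omega)) => [|i _]; last first.
    by apply: eq_bigr => j _; rewrite !mul1r.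
  rewrite big_sym_pairs; last exact: (fun i j => gsm_sym hw i j omega).
  apply: (@le_trans _ _ (\sum_(e in pairs S) (if e.1 == e.2 then 1 else 2) *
     (if e.1 == e.2 then eta * lam else 2 * lam))); last first.
    apply: ler_sum => e eS; rewrite ler_wpM2l//; first by case: ifP.
    by have := Ef e eS; rewrite /B /thr/= in_itv/= andbT.
  rewrite -(@big_sym_pairs _ R S (fun i j => if i == j then eta * lam else 2 * lam)); last first.
    by move=> i j; rewrite eq_sym.
  by rewrite sum_diag_const card_block_set le_eqVlt; apply/orP; left; apply/eqP; ring.
have PE0 f : 0 < fine (P (E f)) by rewrite PE prodr_gt0.
have cardF : #|{ffun 'I_m -> 'I_L}| = (L ^ m)%N by rewrite card_ffun !card_ord.
have := second_moment_bound _ mE PE0 PEE.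
rewrite cardF expn_gt0 L0/= => /(_ isT).
rewrite -lee_fin fineK ?fin_num_measure//.
move=> /le_trans; apply; rewrite lee_fin lerD2r.
rewrite ler_pdivrMr ?exprn_gt0// ?ltr0n ?expn_gt0 ?L0//.
have -> : (1 + (expR gam - 1) / L%:R) ^+ m * (L ^ m)%:R ^+ 2 =
    L%:R ^+ m * (L%:R - 1 + expR gam) ^+ m.
  have -> : 1 + (expR gam - 1) / L%:R = (L%:R - 1 + expR gam) / L%:R.
    by field; rewrite gt_eqF.
  by rewrite natrX expr_div_n; field; rewrite expf_neq0// gt_eqF.
rewrite -sum_agreement; apply: ler_sum => f _; apply: ler_sum => g _.
have gam0 : 0 <= gam.
  rewrite /gam addr_ge0// mulr_ge0 ?divr_ge0// subr_ge0 ler1n; exact: ltnW.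
have Km : (#|block_set mLp f :&: block_set mLp g| <= m)%N.
  by rewrite -[X in (_ <= X)%N](card_block_set mLp f) subset_leq_card// subsetIl.
(* As [gam >= 0], the size of the intersection may be replaced by the number of agreements. *)
rewrite -expRM_natl -[leRHS]invrK -expRN lef_pV2 ?posrE ?expR_gt0 ?prodr_gt0//.
apply: le_trans (pairs_prod_ge Km); rewrite ler_expR lerN2 ler_wpM2r// ler_nat.
exact: card_block_setI.
Qed.

End lower_probability.

(** * Deviations at the scale sqrt (2 D log p) *)

Section deviation.
Context d (T : measurableType d) (R : realType) (P : probability T R).
Variables (eta : R) (p m : nat) (w : 'I_p -> 'I_p -> {RV P >-> R}).
Hypotheses (heta : 0 <= eta <= 2) (hw : gaussian_symmetric_matrix eta w).
Hypothesis hm : (2 <= m <= p)%N.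
Variable eps : R.
Hypothesis eps0 : 0 < eps.

Let D : R := 2 * (m%:R - 1) + eta.
Let l : R := ln p%:R.
Let s := Num.sqrt (2 * D * l).

Hypothesis l0 : 0 < l.

Let m1 : 1 < m%:R :> R.
Proof. by rewrite ltr1n; case/andP: hm. Qed.

Let D0 : 0 < D.
Proof. by have := m1; have /andP[e0 _] := heta; rewrite /D; lra. Qed.

Let p0 : 0 < p%:R :> R.
Proof. by rewrite ltr0n; case/andP: hm => m2 mp; rewrite (leq_trans _ mp)// ltnW. Qed.

Let pE : p%:R = expR l.
Proof. by rewrite /l lnK// posrE. Qed.

Let sE : s ^+ 2 = 2 * D * l.
Proof. by rewrite sqr_sqrtr// !mulr_ge0// ltW. Qed.

Let s0 : 0 < s.
Proof. by rewrite sqrtr_gt0 !mulr_gt0. Qed.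

(** The choice of [th] makes [th * (1 + eps) = 1/2], so the exponent is [m (1 + eps) l] against
    [m l] from the choice of sets. Half of the surplus [m eps l] absorbs [m^2 ln C]. [th1] is the
    midpoint of [th] and 1/2. *)
Lemma Ttilde_upper_deviation (th : R) (th1 := (th + 2^-1) / 2) : th = (2 * (1 + eps))^-1 ->
  m%:R * ln (chi_const th th1) <= eps / 2 * l ->
  (P [set omega | (1 + eps) * s < Ttilde m w omega]%R <=
    (expR (- (eps / 2 * l)))%:E)%E.
Proof.
have ep := eps0; move=> thE mC.
have th_eps : th * (1 + eps) = 2^-1 by rewrite thE; field; lra.
have th0 : 0 < th by rewrite thE invr_gt0; lra.
have th2 : th < 2^-1 by rewrite -th_eps; nra.
have hth : 0 <= th < th1 by rewrite /th1; apply/andP; split; lra.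
have hth1 : th1 < 2^-1 by rewrite /th1; lra.
have t0 : 0 < (1 + eps) * s by rewrite mulr_gt0 ?s0//; lra.
apply: le_trans (Ttilde_upper_tail heta hw hth hth1 hm t0) _.
have C1 := chi_const_ge1 hth hth1; set C := chi_const th th1 in mC C1 *.
rewrite lee_fin -/D exprMn sE.
have -> : th * (m%:R * ((1 + eps) ^+ 2 * (2 * D * l)) / D) = m%:R * ((1 + eps) * l).
  have -> : m%:R * ((1 + eps) ^+ 2 * (2 * D * l)) / D =
     2 * m%:R * (1 + eps) ^+ 2 * l by field; rewrite gt_eqF.
  have -> : th * (2 * m%:R * (1 + eps) ^+ 2 * l) =
    (th * (1 + eps)) * (2 * m%:R * (1 + eps) * l) by ring.
  by rewrite th_eps; field.
have -> : C = expR (ln C) by rewrite lnK// posrE; lra.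
rewrite pE -!expRM_natl -!expRD ler_expR natrX.
have := m1; have := l0; move: mC; set c := ln C => mC l0' m1'.
have : m%:R * (m%:R * c) <= m%:R * (eps / 2 * l) by rewrite ler_wpM2l.
have : 0 <= (m%:R - 1) * (eps / 2 * l).
  by rewrite mulr_ge0 ?subr_ge0 ?ltW// mulr_gt0// divr_gt0.
nra.
Qed.

(** Collects the remainder in [(x + 1)^2 <= (1 + eps) x^2 + 1 + 1/eps], halved, and the Gaussian
    normalisation. *)
Definition low_const : R := (1 + eps^-1) / 2 + ln (Num.sqrt (2 * pi)).

Lemma ln_sqrt2pi_ge0 : 0 <= ln (Num.sqrt (2 * pi)) :> R.
Proof.
rewrite ln_ge0// -[leLHS]sqrtr1 ler_sqrt; have := pi_ge2 R.
  by move: (pi : R) => q; lra.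
by move: (pi : R) => q; lra.
Qed.

Lemma lower_tail_exp (v x : R) : 0 <= v -> 0 <= x ->
  expR (- ((1 + eps) * x ^+ 2 / 2 + low_const)) <=
  fine (centered_gaussian v `[x * Num.sqrt v, +oo[).
Proof.
move=> v0 x0; have ep := eps0.
rewrite -lee_fin centered_gaussian_fineK//.
apply: le_trans (gaussian_lower_tail v0 x0); rewrite lee_fin.
have q0 : 0 < Num.sqrt (2 * pi) :> R by rewrite sqrtr_gt0 mulr_gt0 ?pi_gt0.
rewrite -[Num.sqrt (2 * pi)]lnK ?posrE// -expRN -expRD ler_expR /low_const.
set c := ln _.
have : (x + 1) ^+ 2 <= (1 + eps) * x ^+ 2 + (1 + eps^-1).
  rewrite -subr_ge0 [leRHS](_ : _ = (eps * x - 1) ^+ 2 / eps).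
    by rewrite divr_ge0 ?sqr_ge0// ltW.
  by field; rewrite gt_eqF.
lra.
Qed.

(** The cost per index is at most [(1 - eps) l + C0 m], while each block has length of order
    [p / m]. The remaining factor exp(- eps l) absorbs [C0 m] and a factor [m^2 <= expR (2 m)]; then
    [(1 + x)^m <= expR (m x)]. *)
Lemma Ttilde_lower_deviation : eps < 1 ->
  (low_const + 2) * m%:R <= eps / 2 * l ->
  (P [set omega | Ttilde m w omega < (1 - eps) * s]%R <=
    (expR (2 * expR (- (eps / 2 * l))) - 1)%:E)%E.
Proof.
move=> eps1 mC; have ep := eps0; have /andP[eta0 eta2] := heta.
have /andP[m2 mp] := hm.
have D0' := D0; have l0' := l0; have m1' := m1.
set C0 := low_const in mC *.
have C00 : 0 <= C0.
  have := ln_sqrt2pi_ge0; rewrite /C0 /low_const; set c := ln _ => c0.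
  have : 0 <= eps^-1 by rewrite invr_ge0 ltW.
  lra.
pose lam := (1 - eps) * s / D.
have lam0 : 0 <= lam by rewrite /lam divr_ge0 ?(ltW D0)// mulr_ge0 ?(ltW s0)//; lra.
have lamD : lam * D = (1 - eps) * s by rewrite /lam divfK// gt_eqF.
have lam2 : lam ^+ 2 * D = 2 * (1 - eps) ^+ 2 * l.
  rewrite /lam expr_div_n exprMn sE; field; by rewrite gt_eqF.
(* Costs from [lower_tail_exp] at [2 * lam] off the diagonal, and at [lam * Num.sqrt eta] on it,
   where the standard deviation is [Num.sqrt eta]. *)
pose al := (1 + eps) * (2 * lam) ^+ 2 / 2 + C0.
pose be := (1 + eps) * (lam * Num.sqrt eta) ^+ 2 / 2 + C0.
have al0 : 0 <= al by rewrite addr_ge0// divr_ge0// mulr_ge0 ?sqr_ge0//; lra.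
have be0 : 0 <= be by rewrite addr_ge0// divr_ge0// mulr_ge0 ?sqr_ge0//; lra.
have hal : expR (- al) <= fine (centered_gaussian 1 `[2 * lam, +oo[).
  by have := @lower_tail_exp 1 (2 * lam) ler01; rewrite sqrtr1 mulr1; apply; rewrite mulr_ge0.
have hbe : expR (- be) <= fine (centered_gaussian eta `[eta * lam, +oo[).
  have -> : eta * lam = lam * Num.sqrt eta * Num.sqrt eta.
    by rewrite -mulrA -expr2 sqr_sqrtr// mulrC.
  by apply: lower_tail_exp => //; rewrite mulr_ge0.
pose L := (p %/ m)%N.
have mpos : (0 < m)%N by rewrite ltnW.
have L0 : (0 < L)%N by rewrite divn_gt0.
have mLp : (m * L <= p)%N by rewrite mulnC leq_trunc_div.
have := Ttilde_lower_tail hw m2 L0 mLp al0 be0 hal hbe.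
rewrite -/D lamD => /le_trans; apply; rewrite lee_fin lerD2r.
set gam := be + _.
have L0' : 0 < L%:R :> R by rewrite ltr0n.
have gam_le : gam <= (1 - eps) * l + C0 * m%:R.
  (* The quadratic parts recombine through [eta + 2 (m - 1) = D]. *)
  have -> : gam = (1 + eps) / 2 * (lam ^+ 2 * D) + C0 * (1 + (m%:R - 1) / 2).
    by rewrite /gam /al /be exprMn sqr_sqrtr// /D; field.
  rewrite lam2.
  have : C0 * (1 + (m%:R - 1) / 2) <= C0 * m%:R by rewrite ler_wpM2l//; lra.
  have : (1 + eps) * (1 - eps) <= 1 by nra.
  have : 0 <= (1 - eps) * l by rewrite mulr_ge0 ?ltW//; lra.
  nra.
(* The remainder of [p] modulo [m] is below [m], hence at most [m * L] because [L >= 1]. *)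
have pmL : p%:R <= 2 * m%:R * L%:R :> R.
  rewrite -!natrM ler_nat -mulnA mul2n -addnn {1}(divn_eq p m) -/L [(L * m)%N]mulnC.
  by rewrite leq_add2l (leq_trans (ltnW (ltn_pmod _ mpos)))// leq_pmulr.
have GL : m%:R * ((expR gam - 1) / L%:R) <= 2 * expR (- (eps / 2 * l)).
  rewrite mulrA ler_pdivrMr//.
  have h1 : m%:R * (expR gam - 1) <= m%:R * expR gam by rewrite ler_wpM2l// gerBl.
  apply: le_trans h1 _.
  have h2 : m%:R * m%:R <= expR (2 * m%:R) :> R.
    rewrite [2 * _]mulr_natl mulr2n expRD; apply: ler_pM => //;
    by apply: le_trans (expR_ge1Dx _); rewrite lerDr.
  (* Multiplying by [m] produces the [m * m] of [h2] on the left and the [m * L] of [pmL] on the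
     right. *)
  rewrite -(ler_pM2l (lt_trans ltr01 m1')).
  apply: (@le_trans _ _ (expR (2 * m%:R) * expR gam)).
    by rewrite mulrA ler_wpM2r ?expR_ge0.
  apply: (@le_trans _ _ (expR (- (eps / 2 * l)) * p%:R)).
    rewrite pE -!expRD ler_expR; nra.
  rewrite [leRHS](_ : _ = expR (- (eps / 2 * l)) * (2 * m%:R * L%:R)); last by ring.
  by rewrite ler_wpM2l ?expR_ge0.
apply: (@le_trans _ _ (expR ((expR gam - 1) / L%:R) ^+ m)).
  apply: lerXn2r; rewrite ?nnegrE ?expR_ge0 ?expR_ge1Dx//.
  have -> : 1 + (expR gam - 1) / L%:R = (L%:R + (expR gam - 1)) / L%:R.
    by field; rewrite gt_eqF.
  rewrite divr_ge0//.
  have := expR_ge0 gam; have : 1 <= L%:R :> R by rewrite ler1n.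
  lra.
by rewrite -expRM_natl ler_expR.
Qed.

End deviation.

(** * Growth of log p and of m relative to it *)

Section growth.
Variables (R : realType) (p m : nat -> nat).
Hypothesis hp : p n @[n --> \oo] --> \oo.

Lemma ln_dim_ge (A : R) : \forall n \near \oo, A <= ln (p n)%:R.
Proof.
near=> n.
have pn : (Num.bound (expR A) <= p n)%N by near: n; exact: (cvgnyPge p).1.
rewrite -(expRK A) ler_ln ?posrE ?expR_gt0//.
  by rewrite (le_trans (ltW (archi_boundP (expR_ge0 A))))// ler_nat.
by rewrite (lt_le_trans (expR_gt0 A))// (le_trans (ltW (archi_boundP (expR_ge0 A))))// ler_nat.
Unshelve. all: by end_near. Qed.

(** Both alternatives give m = o(log p). In the second, (log p)^(1/3) / log log p is at most log p
    once log log p >= 1, which [expR 1 <= ln (p n)] ensures. *)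
Lemma assumption2_log (c : R) : assumption2 R p m -> 0 < c ->
  \forall n \near \oo, (m (p n))%:R <= c * ln (p n)%:R.
Proof.
move=> [[m0 hm0] c0|[_ /eqoP ho] c0].
  near=> n; rewrite hm0 mulrC -ler_pdivrMr//.
  by near: n; exact: ln_dim_ge.
near=> n.
have l1 : expR 1 <= ln (p n)%:R :> R by near: n; exact: ln_dim_ge.
have l1' : 1 <= ln (p n)%:R :> R.
  by apply: le_trans l1; rewrite -[leLHS]expR0 ler_expR.
have ll1 : 1 <= ln (ln (p n)%:R) :> R.
  by rewrite -[leLHS](expRK 1) ler_ln// posrE ?expR_gt0// (lt_le_trans ltr01).
have : `|(m (p n))%:R : R^o| <= c * `|ln (p n)%:R `^ 3^-1 / ln (ln (p n)%:R) : R^o|.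
  near: n; exact: ho.
rewrite ger0_norm// => /le_trans; apply; apply: (ler_wpM2l (ltW c0)).
rewrite ger0_norm; last by rewrite divr_ge0 ?powR_ge0// (le_trans ler01).
rewrite ler_pdivrMr ?(lt_le_trans ltr01)//.
apply: (@le_trans _ _ (ln (p n)%:R)); last by rewrite ler_peMr// (le_trans ler01).
by rewrite -[leRHS]powRr1 ?(le_trans ler01)// ler_powR// invf_le1// ler1n.
Unshelve. all: by end_near. Qed.

End growth.

(** * Convergence in probability of the normalised maximum *)

Theorem theorem3 (R : realType) (eta : R)
    (p m : nat -> nat)
    (d : nat -> measure_display)
    (Omega : forall n : nat, measurableType (d n))
    (P : forall n : nat, probability (Omega n) R)
    (w : forall n : nat, 'I_(p n) -> 'I_(p n) -> {RV (P n) >-> R})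
    (heta : 0 <= eta <= 2)
    (hp : p n @[n --> \oo] --> \oo)
    (hm : forall n : nat, (2 <= m (p n) <= p n)%N)
    (hA2 : assumption2 R p m)
    (hw : forall n : nat, gaussian_symmetric_matrix eta (w n)) :
  cvg_in_probability P
    (fun n omega =>
       Ttilde (m (p n)) (w n) omega
       / Num.sqrt ((4 * ((m (p n))%:R - 1) + 2 * eta) * ln (p n)%:R)) 1.
Proof.
move=> eps eps0.
(* The lower deviation bound asks for a parameter below 1; a deviation larger than [eps] is also
   larger than [a]. *)
pose a := Num.min eps 2^-1.
have a0 : 0 < a by rewrite lt_min eps0/= invr_gt0 ltr0n.
have a1 : a < 1 by rewrite gt_min; apply/orP; right; lra.
have aeps : a <= eps by rewrite ge_min lexx.
pose s n := Num.sqrt ((4 * ((m (p n))%:R - 1) + 2 * eta) * ln (p n)%:R).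
have sE n : Num.sqrt (2 * (2 * ((m (p n))%:R - 1) + eta) * ln (p n)%:R) = s n.
  by congr Num.sqrt; ring.
have mT n : measurable_fun setT (Ttilde (m (p n)) (w n)).
  apply: measurable_Ttilde; first exact: (gsm_sym (hw n)).
  by have /andP[m2 ->] := hm n; rewrite (ltnW m2).
have mX n : measurable_fun setT (fun omega => `|Ttilde (m (p n)) (w n) omega / s n - 1|).
  apply: measurableT_comp => //; apply: measurable_funB => //.
  exact: measurable_funM.
have mE n : measurable [set omega | eps < `|Ttilde (m (p n)) (w n) omega / s n - 1|].
  rewrite (_ : mkset _ = setT `&`
    (fun omega => `|Ttilde (m (p n)) (w n) omega / s n - 1|) @^-1` `]eps, +oo[); last first.
    by rewrite setTI; apply/seteqP; split=> omega /=; rewrite in_itv/= andbT.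
  by apply: mX => //; exact: measurable_itv.
have mU n t : measurable [set omega | t < Ttilde (m (p n)) (w n) omega].
  rewrite (_ : mkset _ = setT `&` Ttilde (m (p n)) (w n) @^-1` `]t, +oo[); last first.
    by rewrite setTI; apply/seteqP; split=> omega /=; rewrite in_itv/= andbT.
  by apply: mT => //; exact: measurable_itv.
have mL n t : measurable [set omega | Ttilde (m (p n)) (w n) omega < t].
  rewrite (_ : mkset _ = setT `&` Ttilde (m (p n)) (w n) @^-1` `]-oo, t[); last first.
    by rewrite setTI; apply/seteqP; split=> omega /=; rewrite in_itv.
  by apply: mT => //; exact: measurable_itv.
apply: cvg_EFin; first by apply: nearW => n; rewrite fin_num_measure.
apply/cvgrPdist_le => del del0.
pose th : R := (2 * (1 + a))^-1.
set C := chi_const th ((th + 2^-1) / 2).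
have lC0 : 0 < `|ln C| + 1 by rewrite ltr_wpDl.
have k0 : 0 < low_const a + 2.
  have := ln_sqrt2pi_ge0 R; rewrite /low_const; set c := ln _ => c0.
  have : 0 <= a^-1 by rewrite invr_ge0 ltW.
  lra.
have x0 : 0 < ln (1 + del / 2) by rewrite ln_gt0// ltrDl divr_gt0.
have a20 : 0 < a / 2 by rewrite divr_gt0.
near=> n.
rewrite sub0r normrN ger0_norm ?fine_ge0// -lee_fin fineK ?fin_num_measure//.
have l1 : 1 <= ln (p n)%:R :> R by near: n; exact: ln_dim_ge.
have l0 : 0 < ln (p n)%:R :> R by exact: lt_le_trans l1.
have hC : (m (p n))%:R * ln C <= a / 2 * ln (p n)%:R.
  apply: (@le_trans _ _ ((m (p n))%:R * (`|ln C| + 1))).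
    by rewrite ler_wpM2l// (le_trans (ler_norm _))// lerDl.
  rewrite -ler_pdivlMr// mulrAC.
  by near: n; apply: assumption2_log => //; rewrite divr_gt0.
have hk : (low_const a + 2) * (m (p n))%:R <= a / 2 * ln (p n)%:R.
  rewrite mulrC -ler_pdivlMr// mulrAC.
  by near: n; apply: assumption2_log => //; rewrite divr_gt0.
(* These thresholds on log p make each of the two deviation bounds at most [del / 2]. *)
have e1 : - ln (del / 2) <= a / 2 * ln (p n)%:R.
  by rewrite [a / 2 * _]mulrC -ler_pdivrMr//; near: n; exact: ln_dim_ge.
have e2 : - ln (ln (1 + del / 2) / 2) <= a / 2 * ln (p n)%:R.
  by rewrite [a / 2 * _]mulrC -ler_pdivrMr//; near: n; exact: ln_dim_ge.
have up := Ttilde_upper_deviation heta (hw n) (hm n) a0 l0 erefl hC.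
rewrite sE in up.
have lo := Ttilde_lower_deviation heta (hw n) (hm n) a0 l0 a1 hk.
rewrite sE in lo.
have s0 : 0 < s n.
  rewrite sqrtr_gt0 mulr_gt0//.
  have /andP[m2 _] := hm n; have /andP[eta0 _] := heta.
  have : 1 < (m (p n))%:R :> R by rewrite ltr1n.
  lra.
have sub : [set omega | eps < `|Ttilde (m (p n)) (w n) omega / s n - 1|] `<=`
    [set omega | (1 + a) * s n < Ttilde (m (p n)) (w n) omega] `|`
    [set omega | Ttilde (m (p n)) (w n) omega < (1 - a) * s n].
  move=> omega /= h; have := le_lt_trans aeps h.
  rewrite -(ltr_pdivrMr _ _ s0) -(ltr_pdivlMr _ _ s0).
  by rewrite lter_normr; case/orP => h'; [left|right]; lra.
apply: (@le_trans _ _ (P n [set omega | ((1 + a) * s n < Ttilde (m (p n)) (w n) omega)%R] +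
    P n [set omega | (Ttilde (m (p n)) (w n) omega < (1 - a) * s n)%R])%E).
  apply: le_trans (measureU2 _ (mU _ _) (mL _ _)).
  by apply: le_measure; rewrite ?inE//; apply: measurableU.
have expR_le (x y : R) : 0 < y -> - ln y <= x -> expR (- x) <= y.
  by move=> y0 yx; rewrite -[y]lnK// ler_expR lerNl.
have d20 : 0 < del / 2 by rewrite divr_gt0.
have -> : del%:E = ((del / 2)%:E + (del / 2)%:E)%E by rewrite -EFinD; congr EFin; field.
apply: leeD; first by apply: le_trans up _; rewrite lee_fin expR_le.
apply: le_trans lo _; rewrite lee_fin lerBlDl.
rewrite -[leRHS]lnK; last by rewrite posrE addr_gt0.
rewrite ler_expR mulrC -ler_pdivlMr//; apply: expR_le => //.
by rewrite divr_gt0.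
Unshelve. all: by end_near. Qed.
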